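(* Let $\tau\in\mathfrak M_{1,c}(X^+)$. Suppose that $\tau$ is mean stable on $Y=\mathbb P^2\setminus\{[1:0:0]\}$. Let $r:=\prod_{L\in\mathrm{Min}(\tau)}\dim_{\mathbb C}(\mathrm{LS}({\cal U}_{f,\tau}(L)))<\infty$. Let $K$ be a compact subset of $Y$ such that $G_\tau(K)\subset K$ and $\bigcup_{L\in\mathrm{Min}(\tau)}L\subset\mathrm{int}(K)$. Let $\alpha\in(0,1)$, $\lambda\in(0,1)$ and $C>0$ be constants such that for each $\varphi\in C^\alpha(K)$ and each $n\in\mathbb N$: $\|M_\tau^{nr}(\varphi)-\pi_{\tau,K}(\varphi)\|_\alpha\le C\lambda^n\|\varphi-\pi_{\tau,K}(\varphi)\|_\alpha$; $\|M_\tau^n(\varphi-\pi_{\tau,K}(\varphi))\|_\alpha\le C\lambda^n\|\varphi-\pi_{\tau,K}(\varphi)\|_\alpha$; $\|M_\tau^n(\varphi-\pi_{\tau,K}(\varphi))\|_\alpha\le C\lambda^n\|\varphi\|_\alpha$; and $\|\pi_{\tau,K}(\varphi)\|_\alpha\le C\|\varphi\|_\alpha$ (such constants exist). Then all of the following hold. (1) $\mathrm{Spec}_{\alpha,K}(M_\tau)\subset\{z\in\mathbb C:|z|\le\lambda\}\cup{\cal U}_{v,\tau}(K)$, where $\mathrm{Spec}_{\alpha,K}(M_\tau)$ is the spectrum of $M_\tau:C^\alpha(K)\to C^\alpha(K)$. (2) Let $\zeta\in\mathbb C\setminus(\{z\in\mathbb C:|z|\le\lambda\}\cup{\cal U}_{v,\tau}(K))$.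 Then $(\zeta I-M_\tau)^{-1}:C^\alpha(K)\to C^\alpha(K)$ is equal to $$(\zeta I-M_\tau)|_{\mathrm{LS}({\cal U}_{f,\tau}(K))}^{-1}\circ\pi_{\tau,K}+\sum_{n=0}^\infty\frac{M_\tau^n}{\zeta^{n+1}}(I-\pi_{\tau,K}),$$ where $I$ denotes the identity on $C^\alpha(K)$.
   Context: $X^+$ is the set of all maps $f(x,y)=(y+\alpha,p(y)-\delta x)$ on $\mathbb C^2$ with $\alpha\in\mathbb C$, $\delta\in\mathbb C\setminus\{0\}$, $p$ a polynomial, $\deg p\ge2$. In $X^+$, $f_j=(y+\alpha_j,p_j(y)-\delta_jx)\to f=(y+\alpha,p(y)-\delta x)$ iff $\alpha_j\to\alpha$, $\delta_j\to\delta$, $\deg p_j=\deg p$ for all large $j$, and the coefficients of $p_j$ converge to those of $p$. $\mathbb C^2\subset\mathbb P^2$ via $(x,y)\mapsto[x:y:1]$; each $f\in X^+$ extends to a holomorphic self-map of $Y=\mathbb P^2\setminus\{[1:0:0]\}$ and is regarded as such. $d$ is the Fubini--Study distance on $\mathbb P^2$. $\mathfrak M_{1,c}(X^+)$: Borel probability measures on $X^+$ with compact support. $G_\tau=\{\gamma_n\circ\cdots\circ\gamma_1:n\in\mathbb N,\gamma_j\in\mathrm{supp}\,\tau\}$; $G_\tau(K)=\bigcup_{g\in G_\tau}g(K)$. $\tau$ is mean stable on $Y$ if there exist $n,m\in\mathbb N$, nonempty open subsets $U_1,\dots,U_m$ of $Y$, a nonempty compact $Q\subset\bigcup_jU_j$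 and $c\in(0,1)$ such that: (a) for each $(\gamma_1,\dots,\gamma_n)\in(\mathrm{supp}\,\tau)^n$, $\gamma_n\circ\cdots\circ\gamma_1(\bigcup_jU_j)\subset Q$, and for each $j$ and $x,y\in U_j$, $d(\gamma_n\circ\cdots\circ\gamma_1(x),\gamma_n\circ\cdots\circ\gamma_1(y))\le c\,d(x,y)$; (b) for each $z\in Y$ there is $f_z\in G_\tau$ with $f_z(z)\in\bigcup_jU_j$. A nonempty compact $L\subset Y$ is a minimal set of $\tau$ if $L=\overline{\{g(z):g\in G_\tau\}}$ for each $z\in L$; $\mathrm{Min}(\tau)$ is the set of these (finite under the hypotheses). For a compact $E\subset Y$ with $G_\tau(E)\subset E$: $C(E)$ is the space of continuous functions $E\to\mathbb C$ with supremum norm; $M_\tau:C(E)\to C(E)$, $M_\tau(\varphi)(z)=\int\varphi(g(z))\,d\tau(g)$; ${\cal U}_{f,\tau}(E)$ is the set of $\varphi\in C(E)$, $\varphi\ne0$, with $M_\tau\varphi=a\varphi$ for some $a\in\mathbb C$, $|a|=1$, and ${\cal U}_{v,\tau}(E)$ is the set of all such $a$. $\mathrm{LS}(A)$: finite complex linear combinations of elements of $A$. ${\cal B}_{0,\tau,K}=\{\varphi\in C(K):M_\tau^n\varphi\to0\}$. Under the hypotheses, $C(K)=\mathrm{LS}({\cal U}_{f,\tau}(K))\oplus{\cal B}_{0,\tau,K}$ with $\mathrm{LS}({\cal U}_{f,\tau}(K))$ finite-dimensional, and $\pi_{\tau,K}:C(K)\to\mathrm{LS}({\cal U}_{f,\tau}(K))$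 is the associated (continuous) projection. For $\alpha\in(0,1)$, $\|\varphi\|_\alpha=\sup_{z\in K}|\varphi(z)|+\sup_{x,y\in K,x\ne y}|\varphi(x)-\varphi(y)|/d(x,y)^\alpha$ and $C^\alpha(K)=\{\varphi\in C(K):\|\varphi\|_\alpha<\infty\}$, a Banach space. *)

(* Defs.v *)
(* The complex numbers are [R[i]], for an arbitrary [R : realType]. *)
From HB Require Import structures.
From mathcomp Require Import all_boot all_order all_algebra.
From mathcomp Require Import complex.
From mathcomp Require Import all_classical all_reals all_analysis.
From mathcomp Require Import ring.
Set Implicit Arguments.
Unset Strict Implicit.
Unset Printing Implicit Defensive.
Import Order.TTheory GRing.Theory Num.Theory numFieldNormedType.Exports.
Local Open Scope classical_set_scope.
Local Open Scope ring_scope.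

Notation normc := ComplexField.Normc.normc.

Lemma normr_normc (R : realType) (z : R[i]) : `|z| = (normc z)%:C%C.
Proof. by case: z. Qed.

Section Gram.
Variables (C : numClosedFieldType) (n : nat).
Local Notation "''[' u , v ]" := (@dotmx C n u v).

Lemma dotmxC (u v : 'rV[C]_n) : '[u, v] = '[v, u]^*.
Proof. by rewrite hermC expr0 mul1r. Qed.

Lemma norm_dotmxC (u v : 'rV[C]_n) : `|'[u, v]| = `|'[v, u]|.
Proof. by rewrite dotmxC norm_conjC. Qed.

Lemma dotmx_unit_le1 (u v : 'rV[C]_n) :
  '[u, u] = 1 -> '[v, v] = 1 -> `|'[u, v]| <= 1.
Proof.
move=> u1 v1; rewrite -(@expr_le1 _ 2)//.
have : `|'[u, v]| ^+ 2 <= '[u, u] * '[v, v] by exact: leif_le (CauchySchwarz _ u v).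
by rewrite u1 v1 mulr1.
Qed.

Lemma dotmx_unit_eq (u v : 'rV[C]_n) :
  '[u, u] = 1 -> '[v, v] = 1 -> `|'[u, v]| = 1 -> u \in <[v]>%VS.
Proof.
move=> u1 v1 uv1.
have : (`|'[u, v]| ^+ 2 == '[u, u] * '[v, v]) = ~~ free [:: u; v].
  by case: (CauchySchwarz (@dotmx C n) u v).
rewrite uv1 u1 v1 mulr1 expr1n eqxx => /esym.
rewrite free_cons span_seq1 seq1_free negb_and !negbK => /orP[//|/eqP v0].
by move: v1; rewrite v0 linear0l => /eqP; rewrite eq_sym oner_eq0.
Qed.

(* The triangle inequality for the angles between lines, with [a], [b], [c] the
   cosines of the angles uv, vw, uw. *)
Lemma dotmx_unit_triangle (u v w : 'rV[C]_n) (a b c x y : C) :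
  '[u, u] = 1 -> '[v, v] = 1 -> '[w, w] = 1 ->
  a = `|'[u, v]| -> b = `|'[v, w]| -> c = `|'[u, w]| ->
  x = sqrtC (1 - a ^+ 2) -> y = sqrtC (1 - b ^+ 2) ->
  a * b <= c + x * y.
Proof.
move=> u1 v1 w1 -> -> -> -> -> {a b c x y}.
pose x := u - '[u, v] *: v; pose y := w - '[w, v] *: v.
have dotBl (a b z : 'rV[C]_n) : '[a - b, z] = '[a, z] - '[b, z].
  by rewrite !dotmxE mulmxBl [LHS]mxE [X in _ + X = _]mxE.
have dotBr (a b z : 'rV[C]_n) : '[z, a - b] = '[z, a] - '[z, b].
  by rewrite dotmxC dotBl rmorphB/= -!dotmxC.
have dotZl c (a z : 'rV[C]_n) : '[c *: a, z] = c * '[a, z].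
  by rewrite !dotmxE -scalemxAl mxE.
have dotZr c (a z : 'rV[C]_n) : '[z, c *: a] = c^* * '[z, a].
  by rewrite dotmxC dotZl rmorphM/= -dotmxC.
have dotx (a b : 'rV[C]_n) :
    '[a - '[a, v] *: v, b - '[b, v] *: v] = '[a, b] - '[a, v] * '[v, b].
  rewrite dotBl !dotBr !dotZl !dotZr v1 !mulr1 -!dotmxC.
  by rewrite (mulrC '[v, b]) subrr subr0.
have xx : '[x, x] = 1 - `|'[u, v]| ^+ 2.
  by rewrite dotx u1 normCK -dotmxC.
have yy : '[y, y] = 1 - `|'[v, w]| ^+ 2.
  by rewrite dotx w1 norm_dotmxC normCK -dotmxC.
have : `|'[x, y]| <= sqrtC '[x, x] * sqrtC '[y, y].
  by exact: leif_le (CauchySchwarz_sqrt _ x y).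
rewrite xx yy dotx => h; rewrite -lerBlDl -normrM.
by rewrite (le_trans _ h)// distrC (le_trans _ (lerB_dist _ _)).
Qed.

End Gram.

Section ProjectivePlane.
Variable R : realType.
Local Notation C := (R[i]).

(* P^2 is the set of lines through the origin of C^3. *)
Record P2 := MkP2 { line :> {vspace 'rV[C]_3}; dim_line : \dim line == 1%N }.

HB.instance Definition _ := [isSub for line].
HB.instance Definition _ := [Choice of P2 by <:].

(* A vector of norm 1 spanning the line. *)
Definition unit_rep (p : P2) : 'rV[C]_3 :=
  (sqrtC (dotmx (vpick p) (vpick p)))^-1 *: vpick p.

End ProjectivePlane.

(* Locked: unfolding it makes unification diverge. *)
HB.lock Definition fs_cos {R : realType} (p q : P2 R) : R :=
  normc (dotmx (unit_rep p) (unit_rep q)).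
Canonical locked_fs_cos := Unlockable fs_cos.unlock.

Section FubiniStudy.
Variable R : realType.
Local Notation C := (R[i]).
Local Notation P2 := (P2 R).
Implicit Types p q s : P2.

(* The Fubini-Study distance. *)
Definition fs_dist (p q : P2) : R := acos (fs_cos p q).

Let vpick_neq0 (p : P2) : vpick p != 0.
Proof. by rewrite vpick0 -dimv_eq0 (eqP (dim_line p)). Qed.

Let dot_gt0 (u : 'rV[C]_3) : u != 0 -> 0 < dotmx u u.
Proof. by move=> u0; rewrite dnorm_gt0. Qed.

Lemma unit_rep1 p : dotmx (unit_rep p) (unit_rep p) = 1.
Proof.
have u0 := dot_gt0 (vpick_neq0 p).
rewrite /unit_rep dnormZ ger0_norm ?invr_ge0 ?sqrtC_ge0 ?ltW//.
by rewrite exprVn sqrtCK mulVf// gt_eqF.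
Qed.

Lemma line_unit_rep p : line p = <[unit_rep p]>%VS.
Proof.
have c0 : (sqrtC (dotmx (vpick p) (vpick p)))^-1 != 0.
  by rewrite invr_eq0 sqrtC_eq0 gt_eqF// dot_gt0// vpick_neq0.
apply/esym/eqP; rewrite eqEdim -memvE memvZ ?memv_pick//=.
by rewrite (eqP (dim_line p)) dim_vline scaler_eq0 negb_or c0 vpick_neq0.
Qed.

Let cosE p q :
  (fs_cos p q)%:C%C = `|dotmx (unit_rep p) (unit_rep q)|.
Proof. by rewrite unlock normr_normc. Qed.

Lemma fs_cos_itv p q : 0 <= fs_cos p q <= 1.
Proof.
by rewrite -!lecR cosE normr_ge0/=; apply: dotmx_unit_le1; exact: unit_rep1.
Qed.

Let fs_cos_itvN p q : -1 <= fs_cos p q <= 1.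
Proof.
have /andP[h0 ->] := fs_cos_itv p q; rewrite andbT.
by rewrite (le_trans _ h0)// lerN10.
Qed.

Let cos_fs_dist p q :
  cos (fs_dist p q) = fs_cos p q.
Proof. by rewrite acosK// in_itv/=; exact: fs_cos_itvN. Qed.

Lemma fs_distxx p : fs_dist p p = 0.
Proof.
rewrite /fs_dist (_ : fs_cos _ _ = 1) ?acos1//.
apply: (@complexI R); rewrite cosE.
by rewrite (_ : dotmx _ _ = 1) ?normr1//; exact: unit_rep1.
Qed.

Lemma fs_dist_positivity p q : fs_dist p q = 0 -> p = q.
Proof.
move=> d0; have := cos_fs_dist p q; rewrite d0 cos0 => e1.
have pq : unit_rep p \in <[unit_rep q]>%VS.
  apply: dotmx_unit_eq; [exact: unit_rep1|exact: unit_rep1|].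
  by rewrite -cosE -e1.
apply: val_inj => /=; apply/eqP.
rewrite eqEdim !(eqP (dim_line _)) andbT.
by rewrite (line_unit_rep p) (line_unit_rep q) -memvE.
Qed.

Lemma fs_cosC p q : fs_cos p q = fs_cos q p.
Proof.
rewrite unlock; have := norm_dotmxC (unit_rep p) (unit_rep q).
move: (dotmx _ _) (dotmx _ _) => a b.
by rewrite !normr_normc => /complexI.
Qed.

Lemma fs_dist_sym p q : fs_dist p q = fs_dist q p.
Proof.
by rewrite /fs_dist fs_cosC.
Qed.

Lemma fs_dist_triangle q p s : fs_dist p s <= fs_dist p q + fs_dist q s.
Proof.
have d0 a b : 0 <= fs_dist a b by exact: acos_ge0 (fs_cos_itvN a b).
have dpi a b : fs_dist a b <= pi by exact: acos_lepi (fs_cos_itvN a b).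
have [h|h] := leP (fs_dist p q + fs_dist q s) pi; last first.
  exact: le_trans (dpi _ _) (ltW h).
have dsqr a b : (sin (fs_dist a b))%:C%C = sqrtC (1 - (fs_cos a b)%:C%C ^+ 2).
  rewrite sin_acos ?fs_cos_itvN//; have := fs_cos_itv a b.
  move: (fs_cos a b) => r /andP[r0 r1].
  have e : 0 <= 1 - r ^+ 2 by rewrite subr_ge0 expr_le1.
  rewrite -(rmorph1 (@real_complex R)) -rmorphXn -rmorphB.
  by rewrite -[in RHS](sqr_sqrtr e) rmorphXn sqrCK// lecR sqrtr_ge0.
have realI (a b c x y : R) :
    a%:C%C * b%:C%C <= c%:C%C + x%:C%C * y%:C%C -> a * b <= c + x * y.
  by rewrite -!rmorphM -rmorphD lecR.
have key : fs_cos p q * fs_cos q s <=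
    fs_cos p s + sin (fs_dist p q) * sin (fs_dist q s).
  apply: realI; exact: (@dotmx_unit_triangle C 3
    (unit_rep p) (unit_rep q) (unit_rep s)
    _ _ _ _ _ (unit_rep1 p) (unit_rep1 q) (unit_rep1 s)
    (cosE p q) (cosE q s) (cosE p s) (dsqr p q) (dsqr q s)).
have : cos (fs_dist p q + fs_dist q s) <= cos (fs_dist p s).
  by rewrite cosD (cos_fs_dist p q) (cos_fs_dist q s) (cos_fs_dist p s) lerBlDr.
have dps : fs_dist p s \in `[0, pi] by rewrite in_itv/= d0 dpi.
have dpqs : fs_dist p q + fs_dist q s \in `[0, pi].
  by rewrite in_itv/= h addr_ge0.
by rewrite !leNgt (ltr_cos dpqs dps).
Qed.

HB.instance Definition _ :=
  isMetric.Build R P2 fs_distxx fs_dist_positivity fs_dist_sym fs_dist_triangle.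

Lemma dim_span1 (v : 'rV[C]_3) : v != 0 -> \dim <[v]>%VS == 1%N.
Proof. by rewrite dim_vline => ->. Qed.

Definition mkP2 (v : 'rV[C]_3) (v0 : v != 0) : P2 := MkP2 (dim_span1 v0).

(* Homogeneous coordinates [x : y : z]. *)
Definition vec3 (x y z : C) : 'rV[C]_3 := \row_j [:: x; y; z]`_j.

Lemma vec3_100_neq0 : vec3 1 0 0 != 0.
Proof. by apply/eqP => /rowP /(_ 0) /eqP; rewrite !mxE/= oner_eq0. Qed.

(* Y = P^2 \ {[1 : 0 : 0]} *)
Definition Yset : set P2 := ~` [set mkP2 vec3_100_neq0].

End FubiniStudy.

Notation Y R := (set_type (@Yset R)).

Definition distY (R : realType) (x y : Y R) : R := mdist (\val x) (\val y).

Section Points.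
Variable R : realType.
Local Notation C := (R[i]).

Definition off_pole (v : 'rV[C]_3) := (v 0 1 != 0) || (v 0 2 != 0).

Lemma off_pole_neq0 v : off_pole v -> v != 0.
Proof. by apply: contraTneq => ->; rewrite /off_pole !mxE eqxx. Qed.

Lemma off_poleP v (v0 : v != 0) : off_pole v <-> Yset (mkP2 v0).
Proof.
split=> [vp e|ne].
  have : v \in line (mkP2 (vec3_100_neq0 R)) by rewrite -e memv_line.
  by move=> /vlineP[c cv]; move: vp; rewrite cv /off_pole !mxE/= mulr0 eqxx.
apply: contra_notT ne; rewrite negb_or !negbK => /andP[/eqP v1 /eqP v2].
have ve : v = v 0 0 *: vec3 1 0 0.
  apply/rowP => -[[|[|[|//]]] k]; rewrite !mxE/=.
  - by rewrite mulr1; congr (v _ _); exact: val_inj.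
  - by rewrite mulr0 -[RHS]v1; congr (v _ _); exact: val_inj.
  - by rewrite mulr0 -[RHS]v2; congr (v _ _); exact: val_inj.
apply: val_inj => /=; apply/eqP.
by rewrite eqEdim !dim_vline v0 vec3_100_neq0 andbT -memvE ve memvZ ?memv_line.
Qed.

(* The point of Y with homogeneous coordinates [v]. *)
Definition mkY v (vp : off_pole v) : Y R :=
  exist _ (mkP2 (off_pole_neq0 vp)) (mem_set ((off_poleP _).1 vp)).

(* Some homogeneous coordinates of a point of Y. *)
Definition repY (q : Y R) : 'rV[C]_3 := vpick (line (\val q)).

Lemma repY_off_pole q : off_pole (repY q).
Proof.
have v0 : repY q != 0 by rewrite vpick0 -dimv_eq0 (eqP (dim_line _)).
apply/(off_poleP v0); case: q v0 => p /[dup] /set_mem Yp pY v0 /=.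
rewrite (_ : mkP2 v0 = p)//; apply: val_inj => /=; apply/eqP.
by rewrite eqEdim -memvE memv_pick/= (eqP (dim_line p)) dim_vline v0.
Qed.

Lemma mkY_eq v w (vp : off_pole v) (wp : off_pole w) :
  (exists c, v = c *: w) -> mkY vp = mkY wp.
Proof.
move=> [c vw]; apply: val_inj; apply: val_inj => /=; apply/eqP.
rewrite eqEdim !dim_vline (off_pole_neq0 vp) (off_pole_neq0 wp) andbT.
by rewrite -memvE vw memvZ ?memv_line.
Qed.

Lemma repY_mkY v (vp : off_pole v) : exists2 c, c != 0 & repY (mkY vp) = c *: v.
Proof.
have /vlineP[c cv] : repY (mkY vp) \in <[v]>%VS by exact: memv_pick.
exists c => //; apply: contraTneq (repY_off_pole (mkY vp)) => c0.
by rewrite cv c0 scale0r /off_pole !mxE eqxx.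
Qed.

Lemma affine_off_pole (x y : C) : off_pole (vec3 x y 1).
Proof. by rewrite /off_pole !mxE/= oner_eq0 orbT. Qed.

(* The embedding (x, y) |-> [x : y : 1] of C^2. *)
Definition affine (xy : C * C) : Y R := mkY (affine_off_pole xy.1 xy.2).

End Points.

Section XPlus.
Variable R : realType.
Local Notation C := (R[i]).

(* The map (x, y) |-> (y + shift, poly y - jac x), with deg poly >= 2; it
   determines its three parameters. *)
Record Xplus := MkXplus {
  shift : C;
  jac : C;
  Xpoly : {poly C};
  jac_neq0 : jac != 0;
  Xpoly_deg : (2 < size Xpoly)%N }.

Definition Xfun (f : Xplus) (xy : C * C) : C * C :=
  (xy.2 + shift f, (Xpoly f).[xy.2] - jac f * xy.1).

HB.instance Definition _ := gen_eqMixin Xplus.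
HB.instance Definition _ := gen_choiceMixin Xplus.

Lemma henon_deg : (2 < size ('X^2 : {poly C}))%N.
Proof. by rewrite size_polyXn. Qed.

HB.instance Definition _ :=
  isPointed.Build Xplus (MkXplus 0 (oner_neq0 C) henon_deg).

(* Convergence for these balls is convergence of the parameters with, eventually,
   constant degree. *)
Definition Xball (f : Xplus) (e : R) (g : Xplus) : Prop :=
  [/\ normc (shift f - shift g) < e, normc (jac f - jac g) < e,
      size (Xpoly f) = size (Xpoly g) &
      forall i, normc ((Xpoly f)`_i - (Xpoly g)`_i) < e].

Let normcD3 (x y z : C) e1 e2 :
  normc (x - y) < e1 -> normc (y - z) < e2 -> normc (x - z) < e1 + e2.
Proof.
move=> h1 h2; rewrite -(subrKA y) (le_lt_trans (le_normcD _ _))//.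
exact: ltrD.
Qed.

Lemma Xball_center f (e : R) : 0 < e -> Xball f e f.
Proof.
by move=> e0; split=> // [||i]; rewrite subrr ComplexField.Normc.normc0.
Qed.

Lemma Xball_sym f g (e : R) : Xball f e g -> Xball g e f.
Proof.
by move=> [? ? ? h]; split=> // [||i]; rewrite -normcN opprB.
Qed.

Lemma Xball_triangle f g h (e1 e2 : R) :
  Xball f e1 g -> Xball g e2 h -> Xball f (e1 + e2) h.
Proof.
move=> [a1 b1 s1 c1] [a2 b2 s2 c2]; split; last first.
- by move=> i; exact: normcD3 (c1 i) (c2 i).
- by rewrite s1.
- exact: normcD3 b1 b2.
- exact: normcD3 a1 a2.
Qed.

HB.instance Definition _ := hasNbhs.Build Xplus (nbhs_ (entourage_ Xball)).
HB.instance Definition _ := @Nbhs_isPseudoMetric.Build R Xplus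
  (entourage_ Xball) erefl Xball Xball_center Xball_sym Xball_triangle erefl.

(* The homogenization of [f], with [n = deg p]:
   [x : y : z] |-> [y z^(n-1) + shift z^n : z^n p(y/z) - jac x z^(n-1) : z^n]. *)
Definition hlift (f : Xplus) (v : 'rV[C]_3) : 'rV[C]_3 :=
  let n := (size (Xpoly f)).-1 in
  let x := v 0 0 in let y := v 0 1 in let z := v 0 2 in
  vec3 (y * z ^+ n.-1 + shift f * z ^+ n)
       (\sum_(i < n.+1) (Xpoly f)`_i * y ^+ i * z ^+ (n - i)
          - jac f * x * z ^+ n.-1)
       (z ^+ n).

Lemma hlift_off_pole f v : off_pole v -> off_pole (hlift f v).
Proof.
case: f => a d p d0 p2; rewrite /hlift /off_pole/= => v0.
rewrite !mxE/=; move: p2 v0.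
case sp : (size p) => [|[|[|n]]]//= _.
have [->|z0] := eqVneq (v 0 2) 0; last by rewrite expf_neq0 ?orbT.
rewrite orbF => y0; rewrite !exprS !mul0r mulr0 subr0 big_ord_recr/= big1; last first.
  move=> i _; rewrite subSn; last by rewrite -ltnS.
  by rewrite exprS mul0r mulr0.
rewrite add0r subnn expr0 mulr1 mulf_neq0 ?expf_neq0//.
by rewrite -[X in p`_X]/(n.+3.-1) -sp -/(lead_coef p) lead_coef_eq0 -size_poly_eq0 sp.
Qed.

Lemma hliftZ f (c : C) v :
  hlift f (c *: v) = c ^+ (size (Xpoly f)).-1 *: hlift f v.
Proof.
case: f => a d p d0 /=; rewrite /hlift /=.
case sp : (size p) => [|[|[|n]]]//= _.
apply/rowP => -[[|[|[|//]]] k]; rewrite !mxE/=.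
- by rewrite !exprMn !exprS; ring.
- rewrite mulrBr mulr_sumr; congr (_ - _); last by rewrite !exprMn !exprS; ring.
  apply: eq_bigr => i _; rewrite !exprMn.
  have -> : c ^+ n.+2 = c ^+ i * c ^+ (n.+2 - i).
    by rewrite -exprD subnKC// -ltnS.
  ring.
- by rewrite exprMn.
Qed.

(* The holomorphic extension of [f] to Y. *)
Definition Xext (f : Xplus) (q : Y R) : Y R :=
  mkY (hlift_off_pole f (repY_off_pole q)).

Lemma Xext_mkY f v (vp : off_pole v) : Xext f (mkY vp) = mkY (hlift_off_pole f vp).
Proof.
apply: mkY_eq; have [c _ ->] := repY_mkY vp.
by exists (c ^+ (size (Xpoly f)).-1); exact: hliftZ.
Qed.

Lemma Xext_affine f xy : Xext f (affine xy) = affine (Xfun f xy).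
Proof.
rewrite /affine Xext_mkY; apply: mkY_eq; exists 1; rewrite scale1r.
have p0 : (0 < size (Xpoly f))%N by apply: leq_trans (Xpoly_deg f).
apply/rowP => -[[|[|[|//]]] k]; rewrite !mxE/= !expr1n ?mulr1//.
rewrite prednK// horner_coef; congr (_ - _).
by apply: eq_bigr => i _; rewrite expr1n mulr1.
Qed.

End XPlus.

(* The library puts the norm topology on [R[i]^o] only. *)
HB.instance Definition _ (R : realType) := NormedModule.copy R[i] R[i]^o.

Section Linear.
Variables (R : realType) (V : lmodType R[i]).
Implicit Types (A H : set V) (nrm : V -> \bar R) (T : V -> V).

Definition LS A : set V :=
  [set v | exists n (c : 'I_n -> R[i]) (a : 'I_n -> V),
     (forall i, A (a i)) /\ v = \sum_(i < n) c i *: a i].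

Definition lin_indep n (b : 'I_n -> V) :=
  forall c : 'I_n -> R[i], \sum_(i < n) c i *: b i = 0 -> forall i, c i = 0.

Definition has_dim A (n : nat) :=
  exists b : 'I_n -> V, lin_indep b /\ A = LS (range b).

(* 0 when [A] is not a finite-dimensional subspace. *)
Definition dimC A : nat := xget 0%N [set n | has_dim A n].

(* Bounded operators and their norm on the space [H], normed by [nrm]; an
   operator on [H] is a function on [V] whose values off [H] are irrelevant. *)
Definition bounded_op H nrm T :=
  [/\ forall v, H v -> H (T v),
      forall (c : R[i]) u v, H u -> H v -> T (c *: u + v) = c *: T u + T v &
      exists B : R, forall v, H v -> (nrm (T v) <= B%:E * nrm v)%E].

Definition op_norm H nrm T : \bar R :=
  ereal_sup [set nrm (T v) | v in [set v | H v /\ (nrm v <= 1)%E]].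

(* The two-sided inverse of [T : H -> H] when [T] is a bijection of [H]. *)
Definition inv_on H T : V -> V := 'pinv_(fun=> 0) H T.

(* [zeta I - T] *)
Definition zIsub (zeta : R[i]) T : V -> V := fun v => zeta *: v - T v.

(* Invertibility in the algebra of bounded operators on [H]. *)
Definition invertible_op H nrm T :=
  [/\ bounded_op H nrm T, set_bij H H T & bounded_op H nrm (inv_on H T)].

Definition spectrum H nrm T : set R[i] :=
  [set zeta | ~ invertible_op H nrm (zIsub zeta T)].

End Linear.


Section Dynamics.
Variable R : realType.
Local Notation C := (R[i]).
Local Notation Y := (Y R).
Local Notation X := (Xplus R).
(* [X] with its Borel sigma-algebra. *)
Local Notation XBorel := (g_sigma_algebraType (@open X)).
Variable tau : probability XBorel R.

Definition supp : set X :=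
  [set f | forall U : set X, open U -> U f -> (0 < tau (U : set XBorel))%E].

(* [word [:: g_1; ...; g_n]] is g_n o ... o g_1. *)
Definition word (s : seq X) (z : Y) : Y := foldl (fun w g => Xext g w) z s.

Definition supp_words (n : nat) : set (seq X) :=
  [set s | size s = n /\ forall g, g \in s -> supp g].

(* The semigroup G_tau; words are nonempty. *)
Definition Gtau : set (Y -> Y) :=
  [set g | exists n s, [/\ (0 < n)%N, supp_words n s & g = word s]].

Definition Gtau_image (K : set Y) : set Y := \bigcup_(g in Gtau) (g @` K).

Definition mean_stable : Prop :=
  exists (n m : nat) (U : 'I_m -> set Y) (Q : set Y) (c : R),
    let UU := \bigcup_j U j in
    [/\ (0 < n)%N /\ (0 < m)%N,
        forall j, open (U j) /\ U j !=set0,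
        [/\ Q !=set0, compact Q & Q `<=` UU],
        0 < c < 1 &
        (forall s, supp_words n s ->
           word s @` UU `<=` Q /\
           forall j x y, U j x -> U j y ->
             distY (word s x) (word s y) <= c * distY x y) /\
        (forall z, exists2 g, Gtau g & UU (g z))].

Definition Mintau : set (set Y) :=
  [set L | [/\ L !=set0, compact L &
               forall z, L z -> L = closure [set g z | g in Gtau]]].

Section Operator.
Variable E : set Y.
Implicit Types phi psi : E -> C.

Definition CE : set (E -> C) := [set phi | continuous phi].

(* Integration is over [supp], where [phi (g z)] is defined if G_tau(E) is
   contained in E; the complement of [supp] is a null set. *)
Definition Mtau phi : E -> C := fun z =>
  let F g := valL_ 0 phi (Xext g (\val z)) in
  Complex (\int[tau]_(g in (supp : set XBorel)) complex.Re (F g))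
          (\int[tau]_(g in (supp : set XBorel)) complex.Im (F g)).

Definition Uf : set (E -> C) :=
  [set phi | [/\ CE phi, phi != 0 &
                 exists2 a : C, normc a = 1 & Mtau phi = a *: phi]].

Definition Uv : set C :=
  [set a | normc a = 1 /\
           exists phi, [/\ CE phi, phi != 0 & Mtau phi = a *: phi]].

(* Supremum of a set of nonnegative quantities, 0 if there is none. *)
Definition sup0 (A : set \bar R) : \bar R := ereal_sup (0%E |` A).

Definition sup_norm phi : \bar R := sup0 [set (normc (phi z))%:E | z in setT].

Definition B0 : set (E -> C) :=
  [set phi | CE phi /\ sup_norm (iter n Mtau phi) @[n --> \oo] --> 0%E].

(* The projection of C(E) = LS(Uf) (+) B0 onto LS(Uf). *)
Definition projLS phi : E -> C := xget 0 [set psi | LS Uf psi /\ B0 (phi - psi)].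

Definition holder_norm (alpha : R) phi : \bar R :=
  (sup_norm phi +
   sup0 [set (normc (phi xy.1 - phi xy.2)
                / distY (\val xy.1) (\val xy.2) `^ alpha)%:E
        | xy in [set xy : E * E | xy.1 != xy.2]])%E.

Definition Calpha (alpha : R) : set (E -> C) :=
  [set phi | CE phi /\ (holder_norm alpha phi < +oo)%E].

Definition Spec (alpha : R) : set C :=
  spectrum (Calpha alpha) (holder_norm alpha) Mtau.

End Operator.

(* The product over Min(tau) of dim LS(U_f(L)). *)
Definition rtau : nat :=
  \big[muln/1%N]_(L \in Mintau) dimC (LS (@Uf L)).

End Dynamics.

(* Main.v *)
Require Import Defs.
From HB Require Import structures.
From mathcomp Require Import all_boot all_order all_algebra.
From mathcomp Require Import complex.
From mathcomp Require Import all_classical all_reals all_analysis.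
From mathcomp Require Import ring lra.
Set Implicit Arguments.
Unset Strict Implicit.
Unset Printing Implicit Defensive.
Import Order.TTheory GRing.Theory Num.Theory numFieldNormedType.Exports.
Local Open Scope classical_set_scope.
Local Open Scope ring_scope.

(** The hypotheses say that the iterates of M = M_tau on phi - pi phi decay like
    lambda ^ n in the Hölder norm. If zeta is outside the disc of radius lambda and
    the set U_v of unimodular eigenvalues, then zeta - M is therefore inverted on the
    kernel of pi by the Neumann series, and on the span W of the unimodular
    eigenfunctions it is diagonal with nonzero entries. Adding the two inverses
    gives the resolvent and the formula for it, with a geometric rate of
    convergence in operator norm.

    For the part on W to be bounded in the Hölder norm it must be expressed by M.
    A function w = pi phi, with phi Hölder, is a finite sum of unimodular
    eigenfunctions, and M^(nr) w - w tends to 0 by the first two bounds. A finite sum of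
    unimodular exponentials that tends to 0 is 0 ([vanishing_unimodular_sum]), so
    M^r w = w ([proj_fixed]). Hence a polynomial p in M kills all such w, where
    p(zeta) is not 0 ([proj_annihilator]), and dividing p - p(zeta) by X - zeta writes
    the inverse of zeta - M as a polynomial in M ([resolvent_W]).

    Two facts about the dynamics enter. First, M preserves the Hölder functions and
    is bounded on them ([Mtau_hbd]), because the maps in the compact set supp tau
    are uniformly Lipschitz on K for the Fubini-Study distance ([Xext_lipschitz]).
    This follows from estimates for the homogeneous lifts to C^3: off the pole they
    are Lipschitz and bounded away from 0 on unit vectors, and the angle between two
    lines is comparable with the distance between suitable unit vectors on them.
    Second, r is not 0. Otherwise the first bound makes pi the identity, so that
    every Hölder function is a finite sum of unimodular eigenfunctions. But mean
    stability makes long words contract a neighbourhood of some point q of a minimal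
    set, so the oscillation of M^k phi near q tends to 0 for every Hölder function
    phi. For a sum of unimodular eigenfunctions this forces phi to be constant near
    q, which the distance to q is not ([Calpha_not_W]). *)

(** * The modulus of a complex number *)

Section NormC.
Variable R : realType.
Implicit Types z w : R[i].

Lemma normc_ge0 z : 0 <= normc z.
Proof. by case: z => a b; exact: sqrtr_ge0. Qed.

Lemma ler_normcD z w : normc (z + w) <= normc z + normc w.
Proof. exact: le_normcD. Qed.

Lemma normc_opp z : normc (- z) = normc z.
Proof. exact: normcN. Qed.

Lemma normcBC z w : normc (z - w) = normc (w - z).
Proof. by rewrite -normc_opp opprB. Qed.

Lemma ler_normcB z w : normc (z - w) <= normc z + normc w.
Proof. by rewrite (le_trans (ler_normcD _ _))// normc_opp. Qed.

Lemma normc_real (a : R) : normc a%:C%C = `|a|.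
Proof. by rewrite /= expr0n addr0 sqrtr_sqr. Qed.

Lemma normc_eq0 z : (normc z == 0) = (z == 0).
Proof.
apply/eqP/eqP => [|->]; first exact: ComplexField.Normc.eq0_normc.
exact: ComplexField.Normc.normc0.
Qed.

Lemma normcX z n : normc (z ^+ n) = normc z ^+ n.
Proof.
elim: n => [|n IH]; first by rewrite !expr0 ComplexField.Normc.normc1.
by rewrite !exprS ComplexField.Normc.normcM IH.
Qed.

Lemma ler_Re_normc z : `|complex.Re z| <= normc z.
Proof. by have := normc_ge_Re z; rewrite normr_normc lecR. Qed.

Lemma ler_Im_normc z : `|complex.Im z| <= normc z.
Proof.
by case: z => a b /=; rewrite -sqrtr_sqr ler_sqrt ?addr_ge0 ?sqr_ge0// lerDr sqr_ge0.
Qed.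

Lemma normc_le_ReIm z : normc z <= `|complex.Re z| + `|complex.Im z|.
Proof.
case: z => a b /=.
have h : 0 <= `|a| + `|b| by rewrite addr_ge0.
rewrite -[leRHS]ger0_norm// -sqrtr_sqr ler_sqrt ?sqr_ge0//.
by rewrite sqrrD !real_normK ?num_real// addrAC lerDl mulrn_wge0// mulr_ge0.
Qed.

End NormC.

(** * Elementary bounds for the sine *)

Section Trigonometry.
Variable R : realType.
Implicit Types x t : R.

Lemma continuous_within_sin (a b : R) : {within `[a, b], continuous (@sin R)}.
Proof. by apply: continuous_subspaceT => z; exact: continuous_sin. Qed.

Lemma sin_le_id x : 0 <= x -> sin x <= x.
Proof.
move=> x0; have [c _] := MVT_segment x0 (fun z _ => is_derive_sin z)
  (@continuous_within_sin 0 x).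
rewrite sin0 !subr0 => ->; rewrite -[leRHS]mul1r ler_wpM2r// cos_le1//.
Qed.

Lemma mul_cos_le_sin x : 0 <= x -> x <= pi -> x * cos x <= sin x.
Proof.
move=> x0 xpi; have [c] := MVT_segment x0 (fun z _ => is_derive_sin z)
  (@continuous_within_sin 0 x).
rewrite in_itv/= sin0 !subr0 => /andP[c0 cx] ->.
rewrite mulrC ler_wpM2r// leNgt ltr_cos ?in_itv/= ?x0 ?c0//.
- by rewrite -leNgt.
- exact: le_trans cx xpi.
Qed.

(** Doubling the angle turns sin t >= t cos t into x <= 2 sin x as long as
    cos (x / 2) ^ 2 >= 1 / 2, which is cos x >= 0. *)
Lemma le_2sin x : 0 <= x -> x <= pi -> 0 <= cos x -> x <= 2 * sin x.
Proof.
move=> x0 xpi cx; set t := x / 2.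
have xt : x = t *+ 2 by rewrite -mulr_natr /t divfK.
have t0 : 0 <= t by rewrite divr_ge0.
have tpi : t <= pi / 2 by rewrite ler_pM2r.
have ct0 : 0 <= cos t.
  by rewrite cos_ge0_pihalf// tpi andbT (le_trans _ t0)// oppr_le0 divr_ge0// pi_ge0.
have tx : t <= pi by apply: le_trans xpi; rewrite /t ler_pdivrMr// ler_peMr// ler1n.
have ht := mul_cos_le_sin t0 tx.
have c2 : 1 <= cos t ^+ 2 *+ 2 by rewrite -subr_ge0 -cos_mulr2n -xt.
clearbody t; move: xt => ->; rewrite sin_mulr2n -[t *+ 2]mulr_natl.
have -> : 2 * (cos t * sin t *+ 2) = 4 * (cos t * sin t) by ring.
have le1 : 2 * t <= 4 * (t * cos t ^+ 2).
  have -> : 4 * (t * cos t ^+ 2) = 2 * t * (cos t ^+ 2 *+ 2) by ring.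
  by rewrite ler_peMr// mulr_ge0.
by rewrite (le_trans le1)// ler_pM2l// expr2 mulrCA ler_wpM2l.
Qed.

End Trigonometry.

(** * Fubini-Study distance and vectors of the lines *)

Section HermitianVectors.
Variables (C : numClosedFieldType) (n : nat).
Local Notation "''[' u , v ]" := (@dotmx C n u v).
Implicit Types u v w : 'rV[C]_n.

Lemma dotmx_sum u v : '[u, v] = \sum_i u 0 i * (v 0 i)^*.
Proof. by rewrite dotmxE mxE; apply: eq_bigr => i _; rewrite !mxE. Qed.

Lemma dotmxDl u v w : '[u + v, w] = '[u, w] + '[v, w].
Proof.
by rewrite !dotmx_sum -big_split; apply: eq_bigr => i _; rewrite mxE mulrDl.
Qed.

Lemma dotmxZl (c : C) u v : '[c *: u, v] = c * '[u, v].
Proof.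
by rewrite !dotmx_sum mulr_sumr; apply: eq_bigr => i _; rewrite mxE mulrA.
Qed.

Lemma dotmxDr u v w : '[w, u + v] = '[w, u] + '[w, v].
Proof. by rewrite dotmxC dotmxDl rmorphD/= -!dotmxC. Qed.

Lemma dotmxZr (c : C) u v : '[u, c *: v] = c^* * '[u, v].
Proof. by rewrite dotmxC dotmxZl rmorphM/= -dotmxC. Qed.

(** The right-hand side bounds the square of the distance from s u to the line
    of v. *)
Lemma dotmx_line_dist (u v : 'rV[C]_n) (s t : C) :
  '[u, u] = 1 -> '[v, v] = 1 ->
  (1 - `|'[u, v]| ^+ 2) * `|s| ^+ 2 <= '[s *: u - t *: v, s *: u - t *: v].
Proof.
move=> u1 v1; set w := s *: u - t *: v.
suff -> : (1 - `|'[u, v]| ^+ 2) * `|s| ^+ 2 = '[w, w] - `|'[w, v]| ^+ 2.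
  by rewrite lerBlDr lerDl exprn_ge0.
rewrite !normCK /w -[- (t *: v)]scaleNr !(dotmxDl, dotmxDr, dotmxZl, dotmxZr) u1 v1.
rewrite (dotmxC v u); move: '[u, v] => d.
rewrite !(rmorphD, rmorphM, rmorphN)/= rmorph1.
by ring.
Qed.

(** Multiplying v by a phase makes the inner product with u real and nonnegative. *)
Lemma dotmx_phase (u v : 'rV[C]_n) :
  '[u, u] = 1 -> '[v, v] = 1 ->
  exists2 c : C, `|c| = 1 &
    '[u - c *: v, u - c *: v] = 2 - 2 * `|'[u, v]|.
Proof.
move=> u1 v1; pose z := '[u, v].
have [c c1 cz] : exists2 c : C, `|c| = 1 & c^* * z = `|z|.
  have [z0|z0] := eqVneq z 0.
    by exists 1; rewrite ?normr1// z0 normr0 mulr0.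
  have nz0 : `|z| != 0 by rewrite normr_eq0.
  exists (z / `|z|); first by rewrite normrM normfV normr_id divff.
  rewrite rmorphM/= fmorphV/= (CrealP (normr_real z)) mulrAC.
  by rewrite (mulrC z^*) -normCK expr2 mulfK.
exists c => //.
have cc : c * c^* = 1 by rewrite -normCK c1 expr1n.
have cz' : c * z^* = `|z|.
  have := congr1 (fun x => x^*) cz; rewrite rmorphM/= conjCK => ->.
  by rewrite (CrealP (normr_real z)).
rewrite -/z -[- (c *: v)]scaleNr !(dotmxDl, dotmxDr, dotmxZl, dotmxZr) u1 v1.
rewrite (dotmxC v u) -/z rmorphN/= !mulNr cz' cz.
by rewrite mulr1 mulrN cc; ring.
Qed.

End HermitianVectors.

Section FubiniStudyVectors.
Variable R : realType.
Local Notation C := (R[i]).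
Implicit Types u v w : 'rV[C]_3.

Definition sqn v : R := \sum_i normc (v 0 i) ^+ 2.
Definition norm1 v : R := \sum_i normc (v 0 i).

Lemma dotmx_sqn v : dotmx v v = (sqn v)%:C%C.
Proof.
rewrite dotmx_sum /sqn rmorph_sum; apply: eq_bigr => i _.
by rewrite -normCK normr_normc -rmorphXn.
Qed.

Lemma norm1_ge0 v : 0 <= norm1 v.
Proof. by apply: sumr_ge0 => i _; exact: normc_ge0. Qed.

Lemma sqn_le_norm1 v : sqn v <= norm1 v ^+ 2.
Proof.
rewrite /sqn /norm1 !big_ord_recl !big_ord0 !addr0.
move: (normc_ge0 (v 0 ord0)); set a := normc _ => a0.
move: (normc_ge0 (v 0 (lift ord0 ord0))); set b := normc _ => b0.
move: (normc_ge0 (v 0 (lift ord0 (lift ord0 ord0)))); set c := normc _ => c0.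
have -> : (a + (b + c)) ^+ 2 =
  a ^+ 2 + (b ^+ 2 + c ^+ 2) + (a * b + a * c + b * c) *+ 2 by ring.
by rewrite lerDl mulrn_wge0// !addr_ge0// mulr_ge0.
Qed.

Lemma sqr_normc_le_sqn v i : normc (v 0 i) ^+ 2 <= sqn v.
Proof.
rewrite /sqn (bigD1 i)//= lerDl sumr_ge0// => j _.
by rewrite exprn_ge0// normc_ge0.
Qed.

Lemma sqn_unit_rep (p : P2 R) : sqn (unit_rep p) = 1.
Proof. by apply: (@complexI R); rewrite -dotmx_sqn unit_rep1. Qed.

Lemma normc_unit_rep (p : P2 R) i : normc (unit_rep p 0 i) <= 1.
Proof.
have := sqr_normc_le_sqn (unit_rep p) i.
by rewrite sqn_unit_rep expr_le1// normc_ge0.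
Qed.

Lemma fs_cosE (p q : P2 R) :
  (fs_cos p q)%:C%C = `|dotmx (unit_rep p) (unit_rep q)|.
Proof. by rewrite unlock normr_normc. Qed.

Lemma fs_cosN1_le1 (p q : P2 R) : -1 <= fs_cos p q <= 1.
Proof.
have /andP[h0 ->] := fs_cos_itv p q; rewrite andbT.
by rewrite (le_trans _ h0)// lerN10.
Qed.

Lemma fs_dist_ge0 (p q : P2 R) : 0 <= fs_dist p q.
Proof. exact: acos_ge0 (fs_cosN1_le1 p q). Qed.

Lemma fs_dist_lepi (p q : P2 R) : fs_dist p q <= pi.
Proof. exact: acos_lepi (fs_cosN1_le1 p q). Qed.

Lemma cos_fs_dist (p q : P2 R) : cos (fs_dist p q) = fs_cos p q.
Proof. by rewrite acosK// in_itv/= fs_cosN1_le1. Qed.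

Lemma fs_dist_le_2sin (p q : P2 R) : fs_dist p q <= 2 * sin (fs_dist p q).
Proof.
apply: le_2sin; [exact: fs_dist_ge0|exact: fs_dist_lepi|].
by rewrite cos_fs_dist; case/andP: (fs_cos_itv p q).
Qed.

(** The angle between the lines of a and b is at most a constant times the
    relative error of replacing a by b: the distance from a to the line of b,
    which is |a| sin, is at most |a - b|. *)
Lemma fs_dist_chord (p q : P2 R) (a b : 'rV[C]_3) (i : 'I_3) :
  a \in line p -> b \in line q ->
  fs_dist p q * normc (a 0 i) <= 2 * norm1 (a - b).
Proof.
rewrite (line_unit_rep p) (line_unit_rep q) => /vlineP[s ->] /vlineP[t ->].
set u := unit_rep p; set v := unit_rep q.
have ui := normc_unit_rep p i.
rewrite mxE ComplexField.Normc.normcM.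
have h : fs_dist p q * (normc s * normc (u 0 i)) <= fs_dist p q * normc s.
  by rewrite ler_wpM2l ?fs_dist_ge0// ler_piMr// normc_ge0.
apply: (le_trans h); have s0 := normc_ge0 s.
apply: (@le_trans _ _ (2 * (sin (fs_dist p q) * normc s))).
  by rewrite mulrA ler_wpM2r// fs_dist_le_2sin.
rewrite ler_pM2l//.
have sin0 : 0 <= sin (fs_dist p q).
  by rewrite sin_ge0_pi// fs_dist_ge0 fs_dist_lepi.
rewrite -(@ler_pXn2r _ 2)// ?nnegrE ?norm1_ge0 ?mulr_ge0//.
apply: le_trans (sqn_le_norm1 _).
rewrite exprMn sin2cos2 cos_fs_dist.
rewrite -lecR -dotmx_sqn rmorphM rmorphB !rmorphXn/= rmorph1 fs_cosE.
rewrite -normr_normc; apply: dotmx_line_dist; exact: unit_rep1.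
Qed.

(** Phases can be chosen so that unit representatives of two lines are as close
    as the lines are: |u - c v| ^ 2 = 2 - 2 cos d = (2 sin (d / 2)) ^ 2. *)
Lemma unit_rep_phase (p q : P2 R) :
  exists2 c : C, normc c = 1 &
    forall i, normc ((unit_rep p - c *: unit_rep q) 0 i) <= fs_dist p q.
Proof.
have [c c1 wwC] := dotmx_phase (unit_rep1 p) (unit_rep1 q).
have c1' : normc c = 1 by apply: (@complexI R); rewrite -normr_normc.
exists c => // i; set w := unit_rep p - c *: unit_rep q.
have ww : sqn w = 2 - 2 * fs_cos p q.
  apply: (@complexI R); rewrite -dotmx_sqn wwC -fs_cosE rmorphB rmorphM/=.
  by rewrite (_ : (2%:C)%C = 2 :> C)// rmorphMn.
have d0 := fs_dist_ge0 p q.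
rewrite -(@ler_pXn2r _ 2)// ?nnegrE ?normc_ge0//.
apply: le_trans (sqr_normc_le_sqn _ _) _; rewrite ww -cos_fs_dist.
set d := fs_dist p q; have -> : d = (d / 2) *+ 2 by rewrite -mulr_natr divfK.
rewrite cos_mulr2n; set t := d / 2.
have t0 : 0 <= t by rewrite divr_ge0.
have st : sin t ^+ 2 <= t ^+ 2.
  rewrite ler_pXn2r ?nnegrE//; first exact: sin_le_id.
  rewrite sin_ge0_pi// t0/= (le_trans _ (fs_dist_lepi p q))//.
  by rewrite ler_pdivrMr// ler_peMr// ler1n.
have e : 2 - 2 * (cos t ^+ 2 *+ 2 - 1) = 4 * sin t ^+ 2.
  by rewrite sin2cos2; ring.
rewrite e; have -> : (t *+ 2) ^+ 2 = 4 * t ^+ 2 by ring.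
by rewrite ler_pM2l.
Qed.

End FubiniStudyVectors.

(** * Uniform estimates for the homogeneous lifts *)

Section BoundedLipschitz.
Variables (R : realType) (T : Type) (dom : T -> Prop) (close : T -> T -> R -> Prop).
Implicit Types G H : T -> R[i].

(** Bounded and Lipschitz functions form a ring. The relation close stands for a
    distance at most t, so that a map and a point of C ^ 3 can be varied together. *)
Definition blip G := exists2 L : R, 0 <= L &
  (forall x, dom x -> normc (G x) <= L) /\
  (forall x y t, dom x -> dom y -> 0 <= t -> close x y t ->
     normc (G x - G y) <= L * t).

Lemma eq_blip G H : (forall x, dom x -> G x = H x) -> blip H -> blip G.
Proof.
move=> e [L L0 [b l]]; exists L => //; split=> [x dx|x y t dx dy t0 c].
  by rewrite e// b.
by rewrite !e// l.
Qed.

Lemma blip_cst (c : R[i]) : blip (fun=> c).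
Proof.
exists (normc c); first exact: normc_ge0.
by split=> // x y t _ _ t0 _; rewrite subrr ComplexField.Normc.normc0
  mulr_ge0// normc_ge0.
Qed.

Lemma blip_coord G (B : R) : 0 <= B -> (forall x, dom x -> normc (G x) <= B) ->
  (forall x y t, close x y t -> normc (G x - G y) <= t) -> blip G.
Proof.
move=> B0 b l; exists (B + 1); first by rewrite addr_ge0.
split=> [x dx|x y t dx dy t0 c]; first by rewrite (le_trans (b _ dx))// lerDl.
by rewrite (le_trans (l _ _ _ c))// ler_peMl// lerDr.
Qed.

Lemma blipD G H : blip G -> blip H -> blip (fun x => G x + H x).
Proof.
move=> [L L0 [b l]] [M M0 [d k]]; exists (L + M); first exact: addr_ge0.
split=> [x dx|x y t dx dy t0 c].
  by rewrite (le_trans (ler_normcD _ _))// lerD// ?b ?d.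
rewrite opprD addrACA (le_trans (ler_normcD _ _))// mulrDl.
by apply: lerD; [exact: l|exact: k].
Qed.

Lemma blipM G H : blip G -> blip H -> blip (fun x => G x * H x).
Proof.
move=> [L L0 [b l]] [M M0 [d k]]; exists (L * M *+ 2).
  by rewrite mulrn_wge0// mulr_ge0.
split=> [x dx|x y t dx dy t0 c].
  rewrite ComplexField.Normc.normcM (@le_trans _ _ (L * M))//.
    by rewrite ler_pM ?normc_ge0 ?b ?d.
  by rewrite mulr2n lerDl mulr_ge0.
have -> : G x * H x - G y * H y = G x * (H x - H y) + (G x - G y) * H y.
  by ring.
rewrite (le_trans (ler_normcD _ _))// mulr2n [leRHS]mulrDl.
rewrite !ComplexField.Normc.normcM lerD//.
  by rewrite -mulrA ler_pM ?normc_ge0// ?b// k.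
by rewrite mulrAC ler_pM ?normc_ge0// ?d// l.
Qed.

Lemma blipN G : blip G -> blip (fun x => - G x).
Proof.
move=> hG; apply: (@eq_blip _ (fun x => -1 * G x)).
  by move=> x _; rewrite mulN1r.
exact: blipM (blip_cst _) hG.
Qed.

Lemma blipX G n : blip G -> blip (fun x => G x ^+ n).
Proof.
move=> hG; elim: n => [|n IH]; first exact: blip_cst.
by under eq_fun do rewrite exprS; exact: blipM.
Qed.

Lemma blip_sum n (G : 'I_n -> T -> R[i]) :
  (forall i, blip (G i)) -> blip (fun x => \sum_(i < n) G i x).
Proof.
elim: n G => [|n IH] G hG.
  by under eq_fun do rewrite big_ord0; exact: blip_cst.
by under eq_fun do rewrite big_ord_recr; apply: blipD => //; exact: IH.
Qed.

End BoundedLipschitz.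

Section LiftEstimates.
Variable R : realType.
Local Notation C := (R[i]).
Local Notation X := (Xplus R).
Implicit Types (f g : X) (u v : 'rV[C]_3).

Definition param_close (x y : X * 'rV[C]_3) (t : R) : Prop :=
  [/\ normc (Defs.shift x.1 - Defs.shift y.1) <= t, normc (jac x.1 - jac y.1) <= t,
      forall i, normc ((Xpoly x.1)`_i - (Xpoly y.1)`_i) <= t &
      forall i, normc (x.2 0 i - y.2 0 i) <= t].

(** The constant 1 is the radius of the ball of maps on which the parameters are
    bounded by this number. *)
Definition param_bound f : R :=
  1 + (normc (Defs.shift f) + normc (jac f) +
       \sum_(i < size (Xpoly f)) normc (Xpoly f)`_i).

(** The homogeneous lifts of all maps near a given one are Lipschitz on the unit
    polydisc, jointly in the map and in the point: near f the degree is
    constant, so they are one polynomial in the parameters and coordinates. *)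
Lemma hlift_lipschitz f0 : exists2 L : R, 0 < L &
  forall f g u v t, Xball f0 1 f -> Xball f0 1 g ->
    (forall i, normc (u 0 i) <= 1) -> (forall i, normc (v 0 i) <= 1) ->
    0 <= t -> param_close (f, u) (g, v) t ->
    forall i, normc (hlift f u 0 i - hlift g v 0 i) <= L * t.
Proof.
pose B := param_bound f0.
have s0 : 0 <= \sum_(i < size (Xpoly f0)) normc (Xpoly f0)`_i.
  by apply: sumr_ge0 => i _; exact: normc_ge0.
have h0 : 0 <= normc (Defs.shift f0) + normc (jac f0) by rewrite addr_ge0// normc_ge0.
have B1 : 1 <= B by rewrite lerDl addr_ge0.
have B0 : 0 <= B by exact: le_trans B1.
pose dom (x : X * 'rV[C]_3) := Xball f0 1 x.1 /\ forall i, normc (x.2 0 i) <= 1.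
have near1 (z w : C) (b : R) : normc (z - w) < 1 -> normc z <= b -> normc w <= 1 + b.
  move=> zw zb; rewrite -(subrK z w) (le_trans (ler_normcD _ _))//.
  by rewrite lerD// normcBC ltW.
have bl i : blip dom param_close (fun x => hlift x.1 x.2 0 i).
  have cX j : blip dom param_close (fun x => x.2 0 j).
    apply: (@blip_coord _ _ _ _ _ 1) => // [x [_ /(_ j)]|x y t [_ _ _ /(_ j)]]//.
  have cS : blip dom param_close (fun x => Defs.shift x.1).
    apply: (@blip_coord _ _ _ _ _ B) => // [x [[h _ _ _] _]|x y t []//].
    apply: near1 h _; rewrite -addrA lerDl addr_ge0// normc_ge0//.
  have cJ : blip dom param_close (fun x => jac x.1).
    apply: (@blip_coord _ _ _ _ _ B) => // [x [[_ h _ _] _]|x y t []//].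
    by apply: near1 h _; rewrite addrAC lerDr addr_ge0// normc_ge0.
  have cP j : blip dom param_close (fun x => (Xpoly x.1)`_j).
    apply: (@blip_coord _ _ _ _ _ B) => // [x [[_ _ _ /(_ j) h] _]|x y t []//].
    apply: near1 h _; set sum := \sum_(i < _) _.
    apply: (@le_trans _ _ sum); last by rewrite lerDr.
    have [jp|jp] := ltnP j (size (Xpoly f0)).
      rewrite /sum (bigD1 (Ordinal jp))//= lerDl sumr_ge0// => k _; exact: normc_ge0.
    by rewrite nth_default// ComplexField.Normc.normc0.
  pose n := (size (Xpoly f0)).-1.
  case: i => -[|[|[|//]]] k.
  - apply: (@eq_blip _ _ _ _ _ (fun x : X * 'rV[C]_3 =>
      x.2 0 1 * x.2 0 2 ^+ n.-1 + Defs.shift x.1 * x.2 0 2 ^+ n)).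
      by move=> x [[_ _ e _] _]; rewrite mxE/= /n e.
    by apply: blipD; apply: blipM => //; exact: blipX.
  - apply: (@eq_blip _ _ _ _ _ (fun x : X * 'rV[C]_3 =>
      \sum_(i < n.+1) (Xpoly x.1)`_i * x.2 0 1 ^+ i * x.2 0 2 ^+ (n - i)
          - jac x.1 * x.2 0 0 * x.2 0 2 ^+ n.-1)).
      by move=> x [[_ _ e _] _]; rewrite mxE/= /n e.
    apply: blipD; last first.
      by apply: blipN; apply: blipM; [exact: blipM|exact: blipX].
    apply: blip_sum => i.
    by apply: blipM; [apply: blipM => //|]; exact: blipX.
  - apply: (@eq_blip _ _ _ _ _ (fun x : X * 'rV[C]_3 => x.2 0 2 ^+ n)).
      by move=> x [[_ _ e _] _]; rewrite mxE/= /n e.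
    exact: blipX.
have [L0 L00 [_ H0]] := bl 0; have [L1 L10 [_ H1]] := bl 1.
have [L2 L20 [_ H2]] := bl 2.
exists (L0 + L1 + L2 + 1); first by rewrite ltr_wpDl// !addr_ge0.
move=> f g u v t hf hg hu hv t0 c i.
have mono L : L <= L0 + L1 + L2 + 1 -> L * t <= (L0 + L1 + L2 + 1) * t.
  exact: ler_wpM2r.
case: i => -[|[|[|//]]] k.
- rewrite (_ : Ordinal k = 0); last exact: val_inj.
  by apply: le_trans (H0 (f, u) (g, v) t _ _ t0 c) (mono _ _) => //; lra.
- rewrite (_ : Ordinal k = 1); last exact: val_inj.
  by apply: le_trans (H1 (f, u) (g, v) t _ _ t0 c) (mono _ _) => //; lra.
- rewrite (_ : Ordinal k = 2); last exact: val_inj.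
  by apply: le_trans (H2 (f, u) (g, v) t _ _ t0 c) (mono _ _) => //; lra.
Qed.

(** Off the pole the lifts of the maps near f0 are bounded away from 0: if z is
    not small, then z ^ n is not; if z is small, then the second coordinate is
    near lead(p) y ^ n. *)
Lemma hlift_lower_bound f0 (kappa : R) : 0 < kappa ->
  exists e m : R, [/\ 0 < e, e <= 1, 0 < m &
    forall f u, Xball f0 e f -> (forall i, normc (u 0 i) <= 1) ->
      kappa <= normc (u 0 1) \/ kappa <= normc (u 0 2) ->
      exists i, m <= normc (hlift f u 0 i)].
Proof.
move=> k0; have [L L0 HL] := hlift_lipschitz f0.
pose n := (size (Xpoly f0)).-1; pose l := normc (lead_coef (Xpoly f0)).
have n1 : (1 < n)%N by rewrite -ltnS prednK ?Xpoly_deg// (leq_trans _ (Xpoly_deg f0)).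
have l0 : 0 < l.
  rewrite lt_neqAle normc_ge0 andbT eq_sym normc_eq0 lead_coef_eq0 -size_poly_gt0.
  by rewrite (leq_trans _ (Xpoly_deg f0)).
pose b := l / 2 * kappa ^+ n.
have b0 : 0 < b by rewrite mulr_gt0 ?divr_gt0 ?exprn_gt0.
(* b bounds the leading term from below when |y| >= kappa; below the threshold t
   for |z|, setting z to 0 costs at most L t <= b / 2. *)
pose t := Num.min kappa (b / (2 * L)).
have t0 : 0 < t by rewrite lt_min k0 divr_gt0// mulr_gt0.
exists (Num.min 1 (l / 2)), (Num.min (b / 2) (t ^+ n)); split.
- by rewrite lt_min ltr01 divr_gt0.
- by rewrite ge_min lexx.
- by rewrite lt_min divr_gt0//= exprn_gt0.
move=> f u hf hu hk.
have [tz|tz] := leP t (normc (u 0 2)).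
  exists 2; rewrite mxE/=; case: hf => _ _ <- _; rewrite -/n normcX.
  by rewrite ge_min lerXn2r ?orbT ?nnegrE// ?(ltW t0)// (le_trans (ltW t0)).
have hy : kappa <= normc (u 0 1).
  by case: hk => // /le_lt_trans /(_ tz); rewrite lt_min ltxx.
exists 1; rewrite ge_min; apply/orP; left.
pose u' := vec3 (u 0 0) (u 0 1) 0.
have hf1 : Xball f0 1 f.
  have lt1 (x : R) : x < Num.min 1 (l / 2) -> x < 1 by rewrite lt_min => /andP[].
  by case: hf => h1 h2 h3 h4; split=> // [||i]; apply: lt1.
have hu' i : normc (u' 0 i) <= 1.
  rewrite mxE; case: i => -[|[|[|//]]] ? /=; [exact: hu|exact: hu|].
  by rewrite expr0n addr0 sqrtr0.
have close : param_close (f, u) (f, u') t.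
  split => /= [||i|i]; rewrite ?subrr ?ComplexField.Normc.normc0 ?(ltW t0)//.
  rewrite mxE; case: i => -[|[|[|//]]] ?/=.
  - by rewrite (_ : Ordinal _ = 0) ?subrr ?ComplexField.Normc.normc0 ?(ltW t0)//; exact: val_inj.
  - by rewrite (_ : Ordinal _ = 1) ?subrr ?ComplexField.Normc.normc0 ?(ltW t0)//; exact: val_inj.
  - by rewrite (_ : Ordinal _ = 2) ?subr0 ?(ltW tz)//; exact: val_inj.
have := HL _ _ _ _ _ hf1 hf1 hu hu' (ltW t0) close 1.
have -> : hlift f u' 0 1 = lead_coef (Xpoly f) * u 0 1 ^+ n.
  rewrite !mxE/=; case: hf => _ _ sf _; rewrite -sf -/n.
  rewrite expr0n -subn1 subn_eq0 leqNgt n1/= mulr0 subr0.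
  rewrite big_ord_recr/= subnn expr0 mulr1 big1 ?add0r; last first.
    by move=> i _; rewrite expr0n subn_eq0 leqNgt ltn_ord mulr0.
  by rewrite /lead_coef -sf.
have Lt : L * t <= b / 2.
  apply: (@le_trans _ _ (L * (b / (2 * L)))).
    by rewrite ler_pM2l// ge_min lexx orbT.
  by rewrite le_eqVlt; apply/orP; left; apply/eqP; field; lra.
have bl : b <= normc (lead_coef (Xpoly f) * u 0 1 ^+ n).
  rewrite ComplexField.Normc.normcM normcX ler_pM ?lerXn2r ?nnegrE ?(ltW k0)//.
  - by rewrite divr_ge0// ltW.
  - by rewrite exprn_ge0// ltW.
  - case: hf => _ _ sf /(_ (size (Xpoly f)).-1); rewrite lt_min => /andP[_].
    rewrite /l /lead_coef sf => h.
    move: h; set z := (Xpoly f0)`_ _; set z' := (Xpoly f)`_ _ => h.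
    by have := ler_normcD (z - z') z'; rewrite subrK; lra.
  - exact: normc_ge0.
move=> h; set z := hlift f u 0 1 in h *; set w := _ * _ in h bl.
have := ler_normcB z (z - w); rewrite subKr; lra.
Qed.

End LiftEstimates.

(** * The maps on Y *)

Section DynamicsOnY.
Variable R : realType.
Local Notation C := (R[i]).
Local Notation X := (Xplus R).
Local Notation Y := (Y R).
Implicit Types (f g : X) (p q : Y) (u v : 'rV[C]_3).

Lemma distYE p q : distY p q = fs_dist (\val p) (\val q).
Proof. by []. Qed.

Lemma distY_ge0 p q : 0 <= distY p q. Proof. exact: fs_dist_ge0. Qed.

Lemma distYxx p : distY p p = 0. Proof. exact: fs_distxx. Qed.

Lemma distYC p q : distY p q = distY q p. Proof. exact: fs_dist_sym. Qed.

Lemma distY_triangle q p (s : Y) : distY p s <= distY p q + distY q s.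
Proof. exact: fs_dist_triangle. Qed.

Lemma distY_eq0 p q : distY p q = 0 -> p = q.
Proof. by move=> /fs_dist_positivity pq; exact: val_inj. Qed.

Lemma ballYE p (e : R) : ball p e = [set q | distY p q < e].
Proof. by rewrite /ball/= /initial_ball ballEmdist. Qed.

Definition urep p : 'rV[C]_3 := unit_rep (\val p).

Lemma normc_urep p i : normc (urep p 0 i) <= 1.
Proof. exact: normc_unit_rep. Qed.

Lemma urep_phase p q : exists2 c : C, normc c = 1 &
  forall i, normc (urep p 0 i - c * urep q 0 i) <= distY p q.
Proof.
have [c c1 h] := unit_rep_phase (\val p) (\val q); exists c => // i.
have := h i; rewrite -/(urep p) -/(urep q).
by move: (urep p) (urep q) => u v; rewrite !mxE.
Qed.

Lemma urep_neq0 p : urep p != 0.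
Proof.
apply/eqP => u0; have := sqn_unit_rep (\val p).
rewrite -/(urep p) u0 /sqn big1 => [/esym/eqP|i _]; first by rewrite oner_eq0.
by rewrite mxE ComplexField.Normc.normc0 expr0n.
Qed.

Lemma mkP2_urep p : mkP2 (urep_neq0 p) = \val p.
Proof. by apply: val_inj => /=; rewrite (line_unit_rep (\val p)). Qed.

Lemma urep_off_pole p : off_pole (urep p).
Proof.
by apply/(off_poleP (urep_neq0 p)); rewrite mkP2_urep; case: p => q /= /set_mem.
Qed.

Lemma mkY_urep p : mkY (urep_off_pole p) = p.
Proof.
by apply: val_inj; apply: val_inj => /=; rewrite (line_unit_rep (\val p)).
Qed.

Lemma XextE f p : Xext f p = mkY (hlift_off_pole f (urep_off_pole p)).
Proof. by rewrite -[in LHS](mkY_urep p) Xext_mkY. Qed.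

Lemma memv_mkY v (vp : off_pole v) (c : C) : c *: v \in line (\val (mkY vp)).
Proof. by rewrite memvZ// memv_line. Qed.

Lemma norm1B_le u v (t : R) :
  (forall i, normc (u 0 i - v 0 i) <= t) -> norm1 (u - v) <= 3 * t.
Proof.
move=> h; rewrite (@le_trans _ _ (\sum_(i < 3) t))//.
  by apply: ler_sum => i _; rewrite 2!mxE.
by rewrite big_const_ord iter_addr_0 mulr_natl.
Qed.

(** A lower bound on the distance from p to the pole [1 : 0 : 0], in coordinates. *)
Definition away (kappa : R) p :=
  kappa <= normc (urep p 0 1) \/ kappa <= normc (urep p 0 2).

Lemma away_le (k k' : R) p : k <= k' -> away k' p -> away k p.
Proof. by move=> kk' [] h; [left|right]; exact: le_trans h. Qed.

Lemma near_away q : exists2 k, 0 < k & forall p, distY q p < k -> away k p.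
Proof.
have ex i : urep q 0 i != 0 -> exists2 k, 0 < k &
    forall p, distY q p < k -> k <= normc (urep p 0 i).
  move=> ui; exists (normc (urep q 0 i) / 2).
    by rewrite divr_gt0// lt_neqAle normc_ge0 andbT eq_sym normc_eq0.
  move=> p qp.
  have [c c1 /(_ i) h] := urep_phase q p.
  have := ler_normcD (urep q 0 i - c * urep p 0 i) (c * urep p 0 i).
  rewrite subrK ComplexField.Normc.normcM c1 mul1r.
  move: h qp; lra.
have /orP[/ex|/ex] := urep_off_pole q => -[k k0 h]; exists k => // p /h; by [left|right].
Qed.

Lemma compact_away (K : set Y) : compact K ->
  exists2 k, 0 < k & forall p, K p -> away k p.
Proof.
move=> /compact_near_coveringP cK.
have : \forall k \near 0^'+, K `<=` away k.
  apply: cK => q _; have [k k0 hk] := near_away q.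
  exists (ball q k, [set k' | 0 < k' <= k]) => /=.
    split; first exact: nbhsx_ballx _ _ k0.
    near=> k'; apply/andP; split; near: k'; first exact: nbhs_right_gt.
    exact: nbhs_right_le.
  move=> [p k'] /= [+ /andP[_ k'k]]; rewrite ballYE => /hk; exact: away_le.
move=> H; near (0:R)^'+ => k; exists k.
  by near: k; exact: nbhs_right_gt.
by near: k; exact: H.
Unshelve. all: by end_near. Qed.

(** Unit vectors keep away from 0 under the lift, so that the angle between the
    images is controlled by the difference of the lifts. *)
Lemma Xext_continuous q (f : X) (e : R) : 0 < e ->
  exists2 d, 0 < d & forall g, Xball f d g -> distY (Xext f q) (Xext g q) < e.
Proof.
move=> e0; have [L L0 HL] := hlift_lipschitz f.
have [k k0 hk] := near_away q.
have [e1 [m [e10 e11 m0 Hm]]] := hlift_lower_bound f k0.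
pose d := Num.min 1 (e * m / (12 * L)).
have d0 : 0 < d by rewrite lt_min ltr01 divr_gt0 ?mulr_gt0.
exists d => // g fg.
have fg1 : Xball f 1 g.
  have lt1 (x : R) : x < d -> x < 1 by rewrite lt_min => /andP[].
  by case: fg => h1 h2 h3 h4; split=> // [||i]; apply: lt1.
have aq : away k q by apply: hk; rewrite distYxx.
have [i hi] := Hm f (urep q) (Xball_center f e10) (normc_urep q) aq.
have := fs_dist_chord i (memv_mkY (hlift_off_pole f (urep_off_pole q)) 1)
  (memv_mkY (hlift_off_pole g (urep_off_pole q)) 1).
rewrite !scale1r => ch.
have hd : norm1 (hlift f (urep q) - hlift g (urep q)) <= 3 * (L * d).
  apply: norm1B_le => j.
  apply: HL => //; [exact: Xball_center|exact: normc_urep|exact: normc_urep|exact: ltW|].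
  case: fg => h1 h2 _ h3; split=> /= [||j'|j']; rewrite ?ltW//.
  by rewrite subrr ComplexField.Normc.normc0.
rewrite !XextE distYE.
rewrite -(ltr_pM2r m0).
move: ch hd hi; set D := fs_dist _ _; set c := normc _; set n := norm1 _.
have D0 : 0 <= D by exact: fs_dist_ge0.
move=> ch hd hi; have : D * m <= D * c by rewrite ler_wpM2l.
have : L * d <= e * m / 12.
  apply: (@le_trans _ _ (L * (e * m / (12 * L)))).
    by rewrite ler_pM2l// ge_min lexx orbT.
  by rewrite le_eqVlt; apply/orP; left; apply/eqP; field; lra.
have : 0 < e * m by rewrite mulr_gt0.
lra.
Qed.

(** The lift is Lipschitz on unit vectors, and the phases of the two unit vectors
    may be chosen so that their difference is at most the angle. *)
Lemma Xext_lipschitz_near f0 (k : R) : 0 < k -> exists e L : R,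
  [/\ 0 < e, 0 <= L & forall f p q, Xball f0 e f -> away k p -> away k q ->
    distY (Xext f p) (Xext f q) <= L * distY p q].
Proof.
move=> k0; have [L L0 HL] := hlift_lipschitz f0.
have [e [m [e0 e1 m0 Hm]]] := hlift_lower_bound f0 k0.
exists e, (6 * L / m); split => //.
  by rewrite divr_ge0 ?mulr_ge0 ?(ltW L0) ?(ltW m0).
move=> f p q ff ap aq.
have ff1 : Xball f0 1 f.
  by case: ff => h1 h2 h3 h4; split=> // [||i]; exact: lt_le_trans e1.
have [i hi] := Hm f (urep p) ff (normc_urep p) ap.
have [c c1 hc] := urep_phase p q.
have := fs_dist_chord i (memv_mkY (hlift_off_pole f (urep_off_pole p)) 1)
  (memv_mkY (hlift_off_pole f (urep_off_pole q)) (c ^+ (size (Xpoly f)).-1)).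
rewrite scale1r -hliftZ => ch.
have hd : norm1 (hlift f (urep p) - hlift f (c *: urep q)) <= 3 * (L * distY p q).
  apply: norm1B_le => j; apply: HL => //.
  - exact: normc_urep.
  - by move=> j'; rewrite mxE ComplexField.Normc.normcM c1 mul1r normc_urep.
  - exact: distY_ge0.
  - split=> /= [||j'|j']; rewrite ?subrr ?ComplexField.Normc.normc0 ?distY_ge0//.
    by rewrite [X in _ - X]mxE hc.
rewrite !XextE -(ler_pM2r m0).
move: ch hd; rewrite -distYE; set D := distY (mkY _) _.
set w := normc _ in hi *; set n := norm1 _.
have D0 : 0 <= D by exact: distY_ge0.
move=> ch hd; have : D * m <= D * w by rewrite ler_wpM2l.
have -> : 6 * L / m * distY p q * m = 6 * (L * distY p q) by field; lra.
lra.
Qed.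

(** Compactness keeps K away from the pole and reduces the maps to finitely many
    neighbourhoods, each with one Lipschitz constant. *)
Lemma Xext_lipschitz (S : set X) (K : set Y) : compact S -> compact K ->
  exists2 L : R, 0 <= L & forall f p q, S f -> K p -> K q ->
    distY (Xext f p) (Xext f q) <= L * distY p q.
Proof.
move=> /compact_near_coveringP cS /compact_away[k k0 hk].
have H : \forall L \near +oo, S `<=` [set f | forall p q, away k p -> away k q ->
    distY (Xext f p) (Xext f q) <= L * distY p q].
  apply: (cS _ (pinfty_nbhs R) (fun L f => forall p q, away k p -> away k q ->
    distY (Xext f p) (Xext f q) <= L * distY p q)) => f0 _.
  have [e [L [e0 L0 HL]]] := Xext_lipschitz_near f0 k0.
  exists (ball f0 e, [set L' | L <= L']) => /=.
    split; first exact: nbhsx_ballx _ _ e0.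
    by apply: nbhs_pinfty_ge; rewrite num_real.
  move=> [f L'] /= [hf LL'] p q ap aq; apply: le_trans (HL _ _ _ hf ap aq) _.
  by rewrite ler_wpM2r// distY_ge0.
near (pinfty_nbhs R) => L; exists L.
  by near: L; apply: nbhs_pinfty_ge; rewrite num_real.
move=> f p q Sf Kp Kq; suff : S `<=` [set f | forall p q, away k p -> away k q ->
    distY (Xext f p) (Xext f q) <= L * distY p q].
  by apply => //; exact: hk.
by near: L; exact: H.
Unshelve. all: by end_near. Qed.

(** Moving a representative v towards the pole changes the line it spans. *)
Lemma no_isolated_point q (e : R) : 0 < e -> exists2 p, p != q & distY q p < e.
Proof.
move=> e0; have [k k0 hk] := near_away q; set u := urep q.
have up := urep_off_pole q.
pose t := e * k / 4; have t0 : 0 < t by rewrite divr_gt0 ?mulr_gt0.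
pose v := vec3 (u 0 0 + t%:C%C) (u 0 1) (u 0 2).
have vp : off_pole v by move: up; rewrite /off_pole !mxE.
have [i hi] : exists i, k <= normc (u 0 i).
  by case: (hk q); rewrite ?distYxx// => h; [exists 1|exists 2].
have uv : u - v = vec3 (- t%:C%C) 0 0.
  apply/rowP => -[[|[|[|//]]] j]; rewrite !mxE/=.
  - by rewrite (_ : Ordinal j = 0) ?opprD ?addNKr ?addrA ?subrr ?add0r//; exact: val_inj.
  - by rewrite (_ : Ordinal j = 1) ?subrr//; exact: val_inj.
  - by rewrite (_ : Ordinal j = 2) ?subrr//; exact: val_inj.
exists (mkY vp).
  apply/eqP => e1; have : v \in line (\val q) by rewrite -e1 memv_line.
  rewrite (line_unit_rep (\val q)) -/(urep q) => /vlineP[c vc].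
  have c1 : c = 1.
    have E j : u 0 j = c * u 0 j -> u 0 j != 0 -> c = 1.
      by move=> + uj; rewrite -{1}(mul1r (u 0 j)) => /(mulIf uj).
    have v1 : v 0 1 = u 0 1 by rewrite !mxE.
    have v2 : v 0 2 = u 0 2 by rewrite !mxE.
    case/orP: up; apply: E; [rewrite -{1}v1|rewrite -{1}v2]; by rewrite vc mxE.
  move: uv; rewrite vc c1 scale1r subrr => /rowP/(_ 0); rewrite !mxE/=.
  by move=> /eqP; rewrite eq_sym oppr_eq0 (inj_eq (@complexI R) t 0) gt_eqF.
have := fs_dist_chord i (memv_mkY up 1) (memv_mkY vp 1).
have -> : mkY up = q.
  by rewrite -[RHS]mkY_urep; apply: mkY_eq; exists 1; rewrite scale1r.
rewrite !scale1r uv.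
have -> : norm1 (vec3 (- t%:C%C) 0 0) = t.
  rewrite /norm1 !big_ord_recl big_ord0 !mxE/= oppr0 !expr0n !addr0 sqrtr0 !addr0.
  by rewrite sqrtr_sqr normrN gtr0_norm.
rewrite -distYE => h; have : distY q (mkY vp) * k <= 2 * t.
  by apply: le_trans h; rewrite ler_wpM2l// distY_ge0.
rewrite -(ltr_pM2r k0) /t => h'; apply: (le_lt_trans h').
have : 0 < e * k by rewrite mulr_gt0.
lra.
Qed.

End DynamicsOnY.

(** * Continuous functions on K *)

Section ContinuousFunctions.
Variable R : realType.
Local Notation C := (R[i]).
Local Notation Y := (Y R).
Variable K : set Y.
Implicit Types (phi psi : K -> C) (x y z : K).

Definition distK x y : R := distY (\val x) (\val y).

Lemma set_val_mem z : K (\val z).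
Proof. by case: z => y /= /set_mem. Qed.

Lemma valL_val phi z : valL_ 0 phi (\val z) = phi z.
Proof. by have := congr1 (fun f => f z) (valLK 0 phi). Qed.

Definition toK (y : Y) (h : K y) : K := exist _ y (mem_set h).

Lemma nbhsKP x (P : set K) :
  nbhs x P <-> exists2 d : R, 0 < d & forall y, distK x y < d -> P y.
Proof.
by rewrite -filter_from_ballE; split=> -[d d0 h]; exists d.
Qed.

Lemma CE_nbhs phi x (A : set C) : CE phi -> nbhs (phi x) A -> nbhs x (phi @^-1` A).
Proof. by move=> h hA; exact: (h x A hA). Qed.

Lemma CEP phi : CE phi <-> forall x (e : R), 0 < e ->
  exists2 d : R, 0 < d & forall y, distK x y < d -> normc (phi x - phi y) < e.
Proof.
split=> h x.
  move=> e e0; have e1 : 0 < e%:C%C :> C by rewrite ltcR.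
  have be : nbhs (phi x) (ball (phi x) e%:C%C) by exact: nbhsx_ballx.
  have bx : nbhs x (phi @^-1` ball (phi x) e%:C%C) by exact: CE_nbhs h be.
  have [d d0 hd] := (nbhsKP x _).1 bx.
  exists d => // y /hd; rewrite /preimage/= -ball_normE/=.
  by rewrite normr_normc ltcR.
move=> A /nbhs_ballP[e /= e0 hA].
have e1 : e = (complex.Re e)%:C%C.
  by case: e e0 {hA} => a b; rewrite ltcE => /andP[/eqP/= -> _].
have re0 : 0 < complex.Re e by move: e0; rewrite {1}e1 ltcR.
suff : nbhs x (phi @^-1` A) by [].
apply: (nbhsKP x _).2; have [d d0 hd] := h x _ re0; exists d => // y /hd hy.
by apply: hA; rewrite -ball_normE/= normr_normc e1 ltcR.
Qed.

Lemma CE_lin (c : C) phi psi : CE phi -> CE psi -> CE (c *: phi + psi).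
Proof.
move=> /CEP h1 /CEP h2; apply/CEP => x e e0.
pose b := normc c + 1; have b0 : 0 < b by rewrite ltr_wpDl// normc_ge0.
have [d1 d10 k1] := h1 x (e / (2 * b)) ltac:(by rewrite divr_gt0 ?mulr_gt0).
have [d2 d20 k2] := h2 x (e / 2) ltac:(by rewrite divr_gt0).
exists (Num.min d1 d2); first by rewrite lt_min d10.
move=> y; rewrite lt_min => /andP[/k1 hy1 /k2 hy2].
have -> : (c *: phi + psi) x - (c *: phi + psi) y =
    c * (phi x - phi y) + (psi x - psi y).
  by rewrite mulrBr opprD addrACA.
apply: (le_lt_trans (ler_normcD _ _)); rewrite ComplexField.Normc.normcM.
rewrite (splitr e) ler_ltD//.
apply: (@le_trans _ _ (b * (e / (2 * b)))).
  by rewrite ler_pM ?normc_ge0// ?lerDl// ltW.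
by rewrite le_eqVlt; apply/orP; left; apply/eqP; field; lra.
Qed.

Lemma CE_bounded phi : compact K -> CE phi -> exists2 b : R, 0 <= b & forall z, normc (phi z) <= b.
Proof.
move=> /compact_near_coveringP cK /CEP cphi.
pose P (b : R) (y : Y) := normc (valL_ 0 phi y) <= b \/ ~ K y.
have H : \forall b \near +oo, K `<=` P b.
  apply: (cK _ (pinfty_nbhs R) P).
  move=> y Ky; have [d d0 hd] := cphi (toK Ky) 1 ltr01.
  exists (ball y d, [set b | normc (phi (toK Ky)) + 1 <= b]) => /=.
    split; first exact: nbhsx_ballx _ _ d0.
    by apply: nbhs_pinfty_ge; rewrite num_real.
  move=> [y' b] /= [+ hb]; rewrite ballYE /= => yy'.
  have [Ky'|] := pselect (K y'); [left|by right].
  have := hd (toK Ky') yy'.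
  rewrite -[X in valL_ 0 phi X]/(\val (toK Ky')) valL_val.
  have := ler_normcD (phi (toK Ky)) (phi (toK Ky') - phi (toK Ky)).
  by rewrite addrC subrK (normcBC (phi (toK Ky'))); move: hb => /=; lra.
near (pinfty_nbhs R) => b; exists b.
  by near: b; apply: nbhs_pinfty_ge; rewrite num_real.
move=> z; suff : K `<=` P b.
  by move=> /(_ (\val z) (set_val_mem z)) []; rewrite ?valL_val// => /(_ (set_val_mem z)).
by near: b.
Unshelve. all: by end_near. Qed.

End ContinuousFunctions.

(** * The support of tau *)

Section Support.
Variable R : realType.
Local Notation X := (Xplus R).
Local Notation XBorel := (g_sigma_algebraType (@open X)).
Variable tau : probability XBorel R.

Lemma open_measurableX (U : set X) : open U -> measurable (U : set XBorel).
Proof. by move=> oU; exact: sub_sigma_algebra. Qed.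

Lemma closed_measurableX (U : set X) : closed U -> measurable (U : set XBorel).
Proof.
move=> cU; rewrite -(setCK U); apply: measurableC.
by apply: open_measurableX; exact: closed_openC.
Qed.

Lemma closed_supp : closed (supp tau).
Proof.
move=> f clf U oU Uf; have [g [sg Ug]] := clf U (open_nbhs_nbhs (conj oU Uf)).
exact: sg.
Qed.

Lemma measurable_supp : measurable (supp tau : set XBorel).
Proof. exact: closed_measurableX closed_supp. Qed.

Lemma probability_fin (A : set XBorel) : measurable A ->
  0 <= fine (tau A) <= 1.
Proof.
move=> mA; have h : tau A \is a fin_num by exact: fin_num_measure.
by rewrite -!lee_fin fineK// measure_ge0 probability_le1.
Qed.

(** The preimage A of an open ray is relatively open in the closed set supp tau,
    hence the intersection of supp tau with the complement of the closure of
    supp tau minus A. *)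
Lemma measurable_fun_supp (G : X -> R) :
  (forall g e, supp tau g -> 0 < e ->
     exists2 d, 0 < d & forall h, supp tau h -> Xball g d h -> `|G g - G h| < e) ->
  measurable_fun (supp tau : set XBorel) (G : XBorel -> R).
Proof.
move=> cG; apply: (measurability _ (measurable_realfun.RGenOInfty.measurableE R)) => //.
move=> _ [_ [a ->] <-].
set A := _ `&` _.
have AE : A = supp tau `&` ~` closure (supp tau `\` A).
  apply/seteqP; split=> [g [sg ag]|g [sg ng]]; last first.
    by apply: contrapT => nA; apply: ng; exact: subset_closure.
  split => // clg; move: ag; rewrite /= in_itv/= andbT => ag.
  have ag0 : 0 < G g - a by rewrite subr_gt0.
  have [d d0 hd] := cG g _ sg ag0.
  have [h [[sh nAh] gh]] := clg (ball g d) (nbhsx_ballx _ _ d0).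
  apply: nAh; split=> //=; rewrite in_itv/= andbT.
  have := hd h sh gh; have := ler_norm (G g - G h); lra.
rewrite AE; apply: measurableI; first exact: measurable_supp.
by apply: measurableC; apply: closed_measurableX; exact: closed_closure.
Qed.

Lemma norm_Rintegral_supp_le (F : X -> R) (e : R) : 0 <= e ->
  tau.-integrable (supp tau : set XBorel) (EFin \o F) ->
  (forall g, supp tau g -> `|F g| <= e) ->
  `|\int[tau]_(g in (supp tau : set XBorel)) F g| <= e.
Proof.
move=> e0 iF Fe; apply: le_trans (le_normr_Rintegral measurable_supp iF) _.
have ic : tau.-integrable (supp tau : set XBorel) (EFin \o (cst e)).
  apply: measurable_bounded_integrable => //; first exact: measurable_supp.
    by rewrite -ge0_fin_numE// fin_num_measure//; exact: measurable_supp.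
  by exists e; split; [exact: num_real|move=> x ex g _ /=; rewrite ger0_norm// ltW].
apply: (@le_trans _ _ (\int[tau]_(g in (supp tau : set XBorel)) e)).
  apply: le_Rintegral => //; first exact: measurable_supp.
  have -> : EFin \o (fun g => `|F g|) = (fun g => `|(EFin \o F) g|%E) by [].
  exact: integrable_abse.
rewrite Rintegral_cst; last exact: measurable_supp.
by rewrite ler_piMr//; case/andP: (probability_fin measurable_supp).
Qed.

End Support.

(** * Hölder bounds *)

Lemma geometric_increments_cvg (R : realType) (u : nat -> R) (A q : R) :
  0 < q < 1 -> (forall k, `|u k.+1 - u k| <= A * q ^+ k) ->
  exists l, forall e, 0 < e -> exists N, forall m, (N <= m)%N -> `|l - u m| <= e.
Proof.
move=> /andP[q0 q1] h.
have cu : cvgn u.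
  have -> : u = (fun n => series (telescope u) n + u 0%N).
    by apply/funext => n; rewrite telescopeK subrK.
  apply: is_cvgD; last exact: is_cvg_cst.
  apply: normed_cvg; apply: (@series_le_cvg _ _ (geometric A q)) => //=.
  - by move=> n; apply: le_trans (h n).
  - by apply: is_cvg_geometric_series; rewrite gtr0_norm.
exists (limn u) => e e0.
have /cvgrPdist_le /(_ e e0) [N _ hN] := cu.
by exists N => m Nm; exact: hN.
Qed.

Section Hoelder.
Variable R : realType.
Local Notation C := (R[i]).
Local Notation Y := (Y R).
Variables (K : set Y) (alpha : R).
Hypothesis alpha_gt0 : 0 < alpha.
Implicit Types (phi psi : K -> C) (x y z : K) (b : R).

(** One real constant bounds both the supremum and the Hölder quotients. This
    determines the Hölder norm up to a factor 2, which is immaterial for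
    boundedness and convergence, and avoids extended reals. *)
Definition hbd b phi := (forall z, normc (phi z) <= b) /\
  (forall x y, normc (phi x - phi y) <= b * distK x y `^ alpha).

Lemma distK_ge0 x y : 0 <= distK x y. Proof. exact: distY_ge0. Qed.

Lemma hbd_le b b' phi : b <= b' -> hbd b phi -> hbd b' phi.
Proof.
move=> bb' [h1 h2]; split=> [z|x y]; first exact: le_trans (h1 z) bb'.
by rewrite (le_trans (h2 x y))// ler_wpM2r// powR_ge0.
Qed.

Lemma hbdD b b' phi psi : hbd b phi -> hbd b' psi -> hbd (b + b') (phi + psi).
Proof.
move=> [h1 h2] [k1 k2]; split=> [z|x y].
  by rewrite (le_trans (ler_normcD _ _))// lerD.
have -> : (phi + psi) x - (phi + psi) y = (phi x - phi y) + (psi x - psi y).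
  by rewrite opprD addrACA.
by rewrite (le_trans (ler_normcD _ _))// mulrDl lerD.
Qed.

Lemma hbdZ (c : C) b phi : hbd b phi -> hbd (normc c * b) (c *: phi).
Proof.
move=> [h1 h2]; split=> [z|x y].
  by rewrite ComplexField.Normc.normcM ler_wpM2l ?normc_ge0.
have -> : (c *: phi) x - (c *: phi) y = c * (phi x - phi y) by rewrite mulrBr.
by rewrite ComplexField.Normc.normcM -mulrA ler_wpM2l ?normc_ge0.
Qed.

Lemma hbdN b phi : hbd b phi -> hbd b (- phi).
Proof.
move=> /(hbdZ (-1)); rewrite scaleN1r normc_opp ComplexField.Normc.normc1.
by rewrite mul1r.
Qed.

Lemma hbdB b b' phi psi : hbd b phi -> hbd b' psi -> hbd (b + b') (phi - psi).
Proof. by move=> h /hbdN; exact: hbdD. Qed.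

Lemma hbd0 : hbd 0 0.
Proof.
by split=> [z|x y]; rewrite ?subrr ComplexField.Normc.normc0// mul0r.
Qed.

Lemma hbd_sum n (b : 'I_n -> R) (phi : 'I_n -> K -> C) :
  (forall i, hbd (b i) (phi i)) -> hbd (\sum_i b i) (\sum_i phi i).
Proof.
elim: n b phi => [|n IH] b phi h; first by rewrite !big_ord0; exact: hbd0.
by rewrite !big_ord_recr/=; apply: hbdD => //; exact: IH.
Qed.

Lemma hbd_CE b phi : hbd b phi -> CE phi.
Proof.
move=> [_ h]; apply/CEP => x e e0.
pose c := `|b| + 1; have c0 : 0 < c by rewrite ltr_wpDl.
exists ((e / c) `^ alpha^-1); first by apply: powR_gt0; rewrite divr_gt0.
move=> y xy; apply: (le_lt_trans (h x y)).
have : distK x y `^ alpha < e / c.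
  rewrite -[ltRHS](@powRr1 _ (e / c)) ?divr_ge0 ?ltW//.
  rewrite -(mulVf (lt0r_neq0 alpha_gt0)) powRrM.
  by rewrite gt0_ltr_powR// nnegrE ?distK_ge0 ?powR_ge0.
move=> H; apply: (@le_lt_trans _ _ (c * distK x y `^ alpha)).
  rewrite ler_wpM2r ?powR_ge0// (le_trans (ler_norm b))// lerDl//.
by rewrite -ltr_pdivlMl// mulrC.
Qed.

Lemma sup0_ge0 (A : set \bar R) : (0 <= Defs.sup0 A)%E.
Proof. by apply: ereal_sup_ubound; left. Qed.

Lemma sup0_ubound (A : set \bar R) a : A a -> (a <= Defs.sup0 A)%E.
Proof. by move=> Aa; apply: ereal_sup_ubound; right. Qed.

Lemma sup0_le (A : set \bar R) a : (0 <= a)%E -> (forall c, A c -> (c <= a)%E) ->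
  (Defs.sup0 A <= a)%E.
Proof. by move=> a0 h; apply: ge_ereal_sup => c [->|/h]. Qed.

Lemma sup_norm_le b phi : 0 <= b -> (forall z, normc (phi z) <= b) ->
  (sup_norm phi <= b%:E)%E.
Proof. by move=> b0 h; apply: sup0_le => // _ [z _ <-]; rewrite lee_fin. Qed.

Lemma le_sup_norm phi z : ((normc (phi z))%:E <= sup_norm phi)%E.
Proof. by apply: sup0_ubound; exists z. Qed.

Local Notation N := (holder_norm alpha).

Lemma holder_norm_ge0 phi : (0 <= N phi)%E.
Proof. by rewrite adde_ge0// sup0_ge0. Qed.

Lemma holder_norm_hbd b phi : (N phi <= b%:E)%E -> hbd b phi.
Proof.
move=> h; split=> [z|x y].
  rewrite -lee_fin; apply: le_trans h; rewrite (le_trans (le_sup_norm _ z))//.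
  by rewrite leeDl// sup0_ge0.
have [->|xy] := eqVneq x y.
  rewrite subrr ComplexField.Normc.normc0 mulr_ge0 ?powR_ge0//.
  by rewrite -lee_fin (le_trans _ h)// holder_norm_ge0.
have d0 : 0 < distK x y.
  rewrite lt_neqAle distK_ge0 andbT eq_sym; apply: contra_neq xy => /distY_eq0.
  exact: val_inj.
rewrite -ler_pdivrMr ?powR_gt0// -lee_fin; apply: le_trans h.
apply: (@le_trans _ _ (Defs.sup0 [set (normc (phi xy.1 - phi xy.2)
    / distY (\val xy.1) (\val xy.2) `^ alpha)%:E
    | xy in [set xy : K * K | xy.1 != xy.2]])).
  by apply: sup0_ubound; exists (x, y).
by rewrite leeDr// sup0_ge0.
Qed.

Lemma hbd_holder_norm b phi : 0 <= b -> hbd b phi -> (N phi <= (b *+ 2)%:E)%E.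
Proof.
move=> b0 [h1 h2]; rewrite mulr2n EFinD; apply: leeD.
  exact: sup_norm_le.
apply: sup0_le => // _ [[x y] /= xy <-]; rewrite lee_fin.
have d0 : 0 < distK x y.
  rewrite lt_neqAle distK_ge0 andbT eq_sym; apply: contra_neq xy => /distY_eq0.
  exact: val_inj.
by rewrite ler_pdivrMr ?powR_gt0// h2.
Qed.

Lemma CalphaP phi : Calpha alpha phi <-> exists2 b, 0 <= b & hbd b phi.
Proof.
split=> [[_ Nfin]|[b b0 h]].
  have f : N phi \is a fin_num by rewrite ge0_fin_numE// holder_norm_ge0.
  exists (fine (N phi)); first by rewrite fine_ge0// holder_norm_ge0.
  by apply: holder_norm_hbd; rewrite fineK.
split; first exact: hbd_CE h.
exact: le_lt_trans (hbd_holder_norm b0 h) (ltry _).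
Qed.

Lemma Calpha_lin (c : C) phi psi : Calpha alpha phi -> Calpha alpha psi ->
  Calpha alpha (c *: phi + psi).
Proof.
move=> /CalphaP[b b0 h] /CalphaP[b' b'0 h']; apply/CalphaP.
exists (normc c * b + b'); first by rewrite addr_ge0 ?mulr_ge0 ?normc_ge0.
by apply: hbdD => //; exact: hbdZ.
Qed.

Lemma Calpha0 : Calpha alpha (0 : K -> C).
Proof. by apply/CalphaP; exists 0 => //; exact: hbd0. Qed.

Lemma CalphaB phi psi : Calpha alpha phi -> Calpha alpha psi ->
  Calpha alpha (phi - psi).
Proof.
by move=> h1 h2; rewrite -scaleN1r addrC; exact: Calpha_lin.
Qed.

Lemma CalphaD phi psi : Calpha alpha phi -> Calpha alpha psi ->
  Calpha alpha (phi + psi).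
Proof. by move=> h1 h2; rewrite -[phi]scale1r; exact: Calpha_lin. Qed.

Lemma CalphaZ (c : C) phi : Calpha alpha phi -> Calpha alpha (c *: phi).
Proof. by move=> h; rewrite -[_ *: _]addr0; apply: Calpha_lin => //; exact: Calpha0. Qed.

Lemma Calpha_sum n (phi : 'I_n -> K -> C) : (forall i, Calpha alpha (phi i)) ->
  Calpha alpha (\sum_i phi i).
Proof.
elim: n phi => [|n IH] phi h; first by rewrite big_ord0; exact: Calpha0.
by rewrite big_ord_recr/=; apply: CalphaD => //; exact: IH.
Qed.

Lemma hbd_geometric (S : nat -> K -> C) (A q : R) : 0 <= A -> 0 < q < 1 ->
  (forall k, hbd (A * q ^+ k) (S k.+1 - S k)) ->
  forall k j, hbd (A / (1 - q) * q ^+ k) (S (k + j)%N - S k).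
Proof.
move=> A0 /andP[q0 q1] h k j; have q1' : 0 < 1 - q by rewrite subr_gt0.
suff : hbd (A / (1 - q) * q ^+ k * (1 - q ^+ j)) (S (k + j)%N - S k).
  have qk i : 0 <= q ^+ i by rewrite exprn_ge0// ltW.
  apply: hbd_le; apply: ler_piMr; last by rewrite lerBlDr lerDl.
  by rewrite mulr_ge0// divr_ge0// ltW.
elim: j => [|j IH].
  by rewrite addn0 !subrr mulr0; exact: hbd0.
have -> : S (k + j.+1)%N - S k = (S (k + j).+1 - S (k + j)%N) + (S (k + j)%N - S k).
  by rewrite subrKA addnS.
have -> : A / (1 - q) * q ^+ k * (1 - q ^+ j.+1) =
    A * q ^+ (k + j) + A / (1 - q) * q ^+ k * (1 - q ^+ j).
  by rewrite exprD exprS; field; exact: lt0r_neq0.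
exact: hbdD.
Qed.

(** Hölder bounds survive pointwise limits, so that a sequence with
    geometrically small increments converges with a geometric rate. *)
Lemma hbd_limit (S : nat -> K -> C) (A q : R) : 0 <= A -> 0 < q < 1 ->
  (forall k, hbd (A * q ^+ k) (S k.+1 - S k)) ->
  exists f : K -> C, forall k, hbd (A / (1 - q) * q ^+ k) (f - S k).
Proof.
move=> A0 q01 h; have G := hbd_geometric A0 q01 h.
have L z : exists w : C, forall e : R, 0 < e -> exists N, forall m, (N <= m)%N ->
    normc (w - S m z) <= e.
  have inc k : normc (S k.+1 z - S k z) <= A * q ^+ k by exact: (h k).1 z.
  have [k|l1 hl1] := @geometric_increments_cvg _
      (fun k => complex.Re (S k z)) A q q01.
    by rewrite -raddfB; exact: le_trans (ler_Re_normc _) (inc k).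
  have [k|l2 hl2] := @geometric_increments_cvg _
      (fun k => complex.Im (S k z)) A q q01.
    by rewrite -raddfB; exact: le_trans (ler_Im_normc _) (inc k).
  exists (Complex l1 l2) => e e0; have e20 : 0 < e / 2 by rewrite divr_gt0.
  have [N1 h1] := hl1 _ e20; have [N2 h2] := hl2 _ e20.
  exists (maxn N1 N2) => m; rewrite geq_max => /andP[/h1 k1 /h2 k2].
  rewrite (le_trans (normc_le_ReIm _))// (splitr e).
  by move: k1 k2; case: (S m z) => a b /= *; exact: lerD.
have [f hf] := choice L; exists f => k.
split=> [z|x y]; apply/ler_addgt0Pl => e e0.
  have [N hN] := hf z e e0; pose m := (k + N)%N.
  have -> : (f - S k) z = (f z - S m z) + (S m - S k) z by rewrite subrKA.
  rewrite (le_trans (ler_normcD _ _))// lerD ?hN ?leq_addl//.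
  exact: (G k N).1.
have e20 : 0 < e / 2 by rewrite divr_gt0.
have [N1 h1] := hf x _ e20; have [N2 h2] := hf y _ e20.
pose m := (k + maxn N1 N2)%N.
have -> : (f - S k) x - (f - S k) y =
    ((f x - S m x) - (f y - S m y)) + ((S m - S k) x - (S m - S k) y).
  have E z : (f - S k) z = (f z - S m z) + (S m - S k) z by rewrite subrKA.
  by rewrite !E opprD addrACA.
rewrite (le_trans (ler_normcD _ _))// lerD//; last exact: (G k _).2.
rewrite (le_trans (ler_normcB _ _))// (splitr e) lerD// ?h1 ?h2//.
  by rewrite (leq_trans (leq_maxl N1 N2))// leq_addl.
by rewrite (leq_trans (leq_maxr N1 N2))// leq_addl.
Qed.

End Hoelder.

(** * The transition operator *)

Section Transfer.
Variable R : realType.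
Local Notation C := (R[i]).
Local Notation X := (Xplus R).
Local Notation XBorel := (g_sigma_algebraType (@open X)).
Local Notation Y := (Y R).
Variables (tau : probability XBorel R) (K : set Y).
Hypothesis supp_compact : compact (supp tau).
Hypothesis K_compact : compact K.
Hypothesis K_inv : forall g y, supp tau g -> K y -> K (Xext g y).
Implicit Types (phi psi : K -> C) (x y z : K).

Local Notation M := (@Mtau R tau K).

Definition actK g (sg : supp tau g) z : K := toK (K_inv sg (set_val_mem z)).

Lemma valL_act phi g (sg : supp tau g) z :
  valL_ 0 phi (Xext g (\val z)) = phi (actK sg z).
Proof. by rewrite -(valL_val phi (actK sg z)). Qed.

Definition orbitF phi z (g : X) : C := valL_ 0 phi (Xext g (\val z)).

Lemma integrable_orbit phi z : CE phi ->
  tau.-integrable (supp tau : set XBorel) (EFin \o (@complex.Re R \o orbitF phi z)) /\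
  tau.-integrable (supp tau : set XBorel) (EFin \o (@complex.Im R \o orbitF phi z)).
Proof.
move=> cphi; have [b b0 hb] := CE_bounded K_compact cphi.
have ct g (e : R) : supp tau g -> 0 < e -> exists2 d, 0 < d & forall h, supp tau h ->
    Xball g d h -> normc (orbitF phi z g - orbitF phi z h) < e.
  move=> sg e0; move/CEP: cphi => /(_ (actK sg z) e e0) [d d0 hd].
  have [d' d'0 hd'] := Xext_continuous (\val z) g d0.
  by exists d' => // h sh gh; rewrite /orbitF !valL_act; apply: hd; exact: hd'.
have I (r : C -> R) : (forall w, `|r w| <= normc w) ->
    (forall w w', r (w - w') = r w - r w') ->
    tau.-integrable (supp tau : set XBorel) (EFin \o (r \o orbitF phi z)).
  move=> hr rB; apply: measurable_bounded_integrable; first exact: measurable_supp.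
  - by rewrite -ge0_fin_numE// fin_num_measure//; exact: measurable_supp.
  - apply: measurable_fun_supp => g e sg e0.
    have [d d0 hd] := ct g e sg e0; exists d => // h sh gh.
    by rewrite /= -rB (le_lt_trans (hr _))// hd.
  - exists b; split; first exact: num_real.
    move=> b' bb' g sg /=; apply: (le_trans (hr _)).
    by rewrite /orbitF valL_act (le_trans (hb _))// ltW.
by split; apply: I => [w|w w']; rewrite ?ler_Re_normc ?ler_Im_normc ?raddfB.
Qed.

Lemma Rintegral_supp_lin3 (a b : R) (F G H : XBorel -> R) :
  tau.-integrable (supp tau : set XBorel) (EFin \o F) ->
  tau.-integrable (supp tau : set XBorel) (EFin \o G) ->
  tau.-integrable (supp tau : set XBorel) (EFin \o H) ->
  \int[tau]_(g in (supp tau : set XBorel)) (a * F g + b * G g + H g) =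
  a * (\int[tau]_(g in (supp tau : set XBorel)) F g) +
  b * (\int[tau]_(g in (supp tau : set XBorel)) G g) +
  \int[tau]_(g in (supp tau : set XBorel)) H g.
Proof.
have mS := measurable_supp tau => iF iG iH.
have iZ (r : R) (F' : XBorel -> R) :
   tau.-integrable (supp tau : set XBorel) (EFin \o F') ->
   tau.-integrable (supp tau : set XBorel) (EFin \o (fun g => r * F' g)).
  by move=> iF'; exact: (integrableZl mS r iF').
rewrite RintegralD//; last exact: (integrableD mS (iZ a _ iF) (iZ b _ iG)).
by rewrite RintegralD ?RintegralZl//; exact: iZ.
Qed.

Lemma Mtau_lin (c : C) phi psi : CE phi -> CE psi ->
  M (c *: phi + psi) = c *: M phi + M psi.
Proof.
move=> cphi cpsi; apply/funext => z.
have [i1 i2] := integrable_orbit z cphi; have [j1 j2] := integrable_orbit z cpsi.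
have E g : supp tau g -> valL_ 0 (c *: phi + psi) (Xext g (\val z)) =
    c * orbitF phi z g + orbitF psi z g.
  by move=> sg; rewrite /orbitF !valL_act.
have EI := Rintegral_supp_lin3 (complex.Re c) (complex.Im c) i2 i1 j2.
have ER := Rintegral_supp_lin3 (complex.Re c) (- complex.Im c) i1 i2 j1.
transitivity (Complex
  (\int[tau]_(g in (supp tau : set XBorel)) (complex.Re c * complex.Re (orbitF phi z g)
     + (- complex.Im c) * complex.Im (orbitF phi z g) + complex.Re (orbitF psi z g)))
  (\int[tau]_(g in (supp tau : set XBorel)) (complex.Re c * complex.Im (orbitF phi z g)
     + complex.Im c * complex.Re (orbitF phi z g) + complex.Im (orbitF psi z g)))).
  congr Complex; apply: eq_Rintegral => g /set_mem /E ->.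
    case: c {E EI ER} => a b; case: (orbitF phi z g) => p q.
    by case: (orbitF psi z g) => p' q' /=; rewrite mulNr.
  case: c {E EI ER} => a b; case: (orbitF phi z g) => p q.
  by case: (orbitF psi z g).
move: EI ER => /= -> ->.
rewrite [RHS]/(c * M phi z + M psi z) /Mtau /=.
by case: c {E} => p q /=; rewrite mulNr.
Qed.

(** The real part of w, or its imaginary part: a complex integral is controlled
    one part at a time, without loss in the constants. *)
Definition part (im : bool) (w : C) : R := if im then complex.Im w else complex.Re w.

Lemma partB im (w w' : C) : part im (w - w') = part im w - part im w'.
Proof. by case: im; rewrite /part raddfB. Qed.

Lemma ler_part_normc im (w : C) : `|part im w| <= normc w.
Proof. by case: im; [exact: ler_Im_normc|exact: ler_Re_normc]. Qed.

Lemma normc_le_part (e : R) (w : C) : (forall im, `|part im w| <= e) -> normc w <= e *+ 2.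
Proof.
move=> h; apply: (le_trans (normc_le_ReIm w)).
by rewrite mulr2n; apply: lerD; [exact: (h false)|exact: (h true)].
Qed.

Lemma part_Mtau im phi z : part im (M phi z) =
  \int[tau]_(g in (supp tau : set XBorel)) part im (orbitF phi z g).
Proof. by case: im. Qed.

Lemma integrable_part im phi z : CE phi ->
  tau.-integrable (supp tau : set XBorel) (EFin \o (part im \o orbitF phi z)).
Proof. by move=> /(integrable_orbit z)[h1 h2]; case: im. Qed.

Lemma part_Mtau_le im phi z (e : R) : CE phi -> 0 <= e ->
  (forall g (sg : supp tau g), `|part im (phi (actK sg z))| <= e) ->
  `|part im (M phi z)| <= e.
Proof.
move=> cphi e0 h; rewrite part_Mtau.
apply: norm_Rintegral_supp_le => //; first exact: integrable_part.
by move=> g sg; rewrite /orbitF (valL_act _ sg).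
Qed.

Lemma part_MtauB_le im phi x y (e : R) : CE phi -> 0 <= e ->
  (forall g (sg : supp tau g),
     `|part im (phi (actK sg x)) - part im (phi (actK sg y))| <= e) ->
  `|part im (M phi x) - part im (M phi y)| <= e.
Proof.
move=> cphi e0 h; have ix := integrable_part im x cphi.
have iy := integrable_part im y cphi.
rewrite !part_Mtau -(RintegralB (measurable_supp tau) ix iy).
apply: norm_Rintegral_supp_le => //.
  exact: (integrableB (measurable_supp tau) ix iy).
by move=> g sg; rewrite /= /orbitF !(valL_act _ sg).
Qed.

(** Integrating k times compares phi at the images of the two points under the
    words of length k. *)
Lemma part_iter_MtauB_le im k phi x y (e : R) : 0 <= e ->
  (forall j, CE (iter j M phi)) ->
  (forall s, supp_words tau k s ->
     `|part im (valL_ 0 phi (word s (\val x)))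
       - part im (valL_ 0 phi (word s (\val y)))| <= e) ->
  `|part im (iter k M phi x) - part im (iter k M phi y)| <= e.
Proof.
move=> e0 cphi; elim: k x y => [|k IH] x y h.
  have := h [::]; rewrite -[word _ (\val x)]/(\val x) -[word _ (\val y)]/(\val y).
  by rewrite !valL_val; apply.
rewrite iterS; apply: part_MtauB_le => // g sg; apply: IH => s [sk ss].
apply: (h (g :: s)); split; first by rewrite /= sk.
by move=> g'; rewrite inE => /predU1P[->//|]; exact: ss.
Qed.

(** The maps in the support have a common Lipschitz constant L on K, so averaging
    phi over them multiplies its Hölder constant by at most L ^ alpha; the factor 2
    comes from treating real and imaginary parts separately. *)
Lemma Mtau_hbd (alpha : R) : 0 < alpha -> exists2 A : R, 0 <= A &
  forall b phi, 0 <= b -> hbd alpha b phi -> hbd alpha (A * b) (M phi).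
Proof.
move=> a0; have [L L0 hL] := Xext_lipschitz supp_compact K_compact.
pose A := (1 + L `^ alpha) *+ 2.
have La : 0 <= L `^ alpha := powR_ge0 _ _.
exists A; first by rewrite mulrn_wge0// addr_ge0.
move=> b phi b0 h; have cphi := hbd_CE a0 h.
case: h => h1 h2; split=> [z|x y].
  apply: (@le_trans _ _ (b *+ 2)).
    apply: normc_le_part => im; apply: part_Mtau_le => // g sg.
    exact: le_trans (ler_part_normc _ _) (h1 _).
  by rewrite /A mulrnAl lerMn2r mulrDl mul1r lerDl mulr_ge0.
pose e := b * (L `^ alpha * distK x y `^ alpha).
have e0 : 0 <= e by rewrite mulr_ge0// mulr_ge0// powR_ge0.
apply: (@le_trans _ _ (e *+ 2)).
  apply: normc_le_part => im; rewrite partB.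
  apply: part_MtauB_le => // g sg; rewrite -partB.
  apply: le_trans (ler_part_normc _ _) _; apply: (le_trans (h2 _ _)).
  have Ld : distK (actK sg x) (actK sg y) <= L * distK x y.
    by apply: hL => //; exact: set_val_mem.
  rewrite ler_wpM2l// -powRM ?distK_ge0//.
  apply: ge0_ler_powR; rewrite ?nnegrE ?distK_ge0 ?mulr_ge0 ?distK_ge0//.
  exact: ltW.
rewrite /A mulrnAl mulrnAl lerMn2r/= mulrDl mul1r mulrDl.
by rewrite /e mulrCA mulrA lerDr mulr_ge0// powR_ge0.
Qed.

End Transfer.

(** * Sums of unimodular eigenfunctions *)

Section UnimodularSums.
Variable R : realType.
Local Notation C := (R[i]).

Definition vanishing (x : nat -> C) :=
  forall e : R, 0 < e -> exists N, forall m, (N <= m)%N -> normc (x m) <= e.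

(** With x m the sum, the sequence x (m + 1) - a x m, for a one of the a i, is a
    sum with one term fewer, hence 0 by induction; then |x m| is constant. *)
Lemma vanishing_unimodular_sum n (a b : 'I_n -> C) :
  (forall i, normc (a i) = 1) ->
  vanishing (fun m => \sum_i a i ^+ m * b i) ->
  forall m, \sum_i a i ^+ m * b i = 0.
Proof.
elim: n a b => [|n IH] a b a1 van m; first by rewrite big_ord0.
pose x m := \sum_i a i ^+ m * b i.
pose c := a ord_max; pose wid (i : 'I_n) := widen_ord (leqnSn n) i.
have y0 : forall m, \sum_i a (wid i) ^+ m * ((a (wid i) - c) * b (wid i)) = 0.
  apply: (IH (a \o wid)) => [i|e e0]; first exact: a1.
  have e20 : 0 < e / 2 by rewrite divr_gt0.
  have [N hN] := van _ e20; exists N => k Nk.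
  rewrite (_ : \sum_i _ = x k.+1 - c * x k); last first.
    rewrite /x mulr_sumr -sumrB big_ord_recr/= -/c exprS mulrA subrr addr0.
    by apply: eq_bigr => i _; rewrite exprS /wid; ring.
  rewrite (le_trans (ler_normcB _ _))// ComplexField.Normc.normcM a1 mul1r.
  by rewrite (splitr e) lerD ?hN// (leq_trans Nk).
have xS k : x k.+1 = c * x k.
  apply/eqP; rewrite -subr_eq0 -(y0 k); apply/eqP.
  rewrite /x mulr_sumr -sumrB big_ord_recr/= -/c exprS mulrA subrr addr0.
  by apply: eq_bigr => i _; rewrite exprS /wid; ring.
have xn k j : normc (x (k + j)%N) = normc (x k).
  elim: j => [|j <-]; first by rewrite addn0.
  by rewrite addnS xS ComplexField.Normc.normcM a1 mul1r.
apply/eqP; rewrite -normc_eq0 -/(x m) eq_le normc_ge0 andbT.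
apply/ler_addgt0Pl => e e0; rewrite addr0.
by have [N hN] := van e e0; rewrite -(xn m N) hN// leq_addl.
Qed.

(** The polynomial p with roots a i gives p(z) w = sum_i p(a i) b i = 0, while p(z)
    is not 0. *)
Lemma unimodular_sum_geometric n (a b : 'I_n -> C) (z w : C) :
  (forall i, a i != z) ->
  (forall m, z ^+ m * w = \sum_i a i ^+ m * b i) -> w = 0.
Proof.
move=> az h; pose p := \prod_i ('X - (a i)%:P).
have hp y : p.[y] = \sum_(k < size p) p`_k * y ^+ k by rewrite horner_coef.
have : p.[z] * w = 0.
  rewrite hp mulr_suml.
  under eq_bigr => k _ do rewrite -mulrA h mulr_sumr.
  rewrite exchange_big big1//= => i _.
  under eq_bigr => k _ do rewrite mulrA.
  rewrite -mulr_suml -hp (_ : p.[a i] = 0) ?mul0r//.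
  by rewrite /p horner_prod (bigD1 i)//= !hornerE subrr mul0r.
move=> /eqP; rewrite mulf_eq0 => /orP[|/eqP//].
rewrite /p horner_prod prodf_seq_eq0 => /hasP[i _ /=].
by rewrite !hornerE subr_eq0 eq_sym (negbTE (az i)).
Qed.

End UnimodularSums.

Section EigenSums.
Variable R : realType.
Local Notation C := (R[i]).
Local Notation X := (Xplus R).
Local Notation XBorel := (g_sigma_algebraType (@open X)).
Local Notation Y := (Y R).
Variables (tau : probability XBorel R) (K : set Y).
Hypothesis K_compact : compact K.
Hypothesis K_inv : forall g y, supp tau g -> K y -> K (Xext g y).
Implicit Types (phi psi w : K -> C) (z : K).

Local Notation M := (@Mtau R tau K).
Local Notation W := (LS (@Uf R tau K)).

Lemma CE0 : CE (0 : K -> C).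
Proof. by apply: (@hbd_CE _ _ 1 _ 0); [exact: ltr01|exact: hbd0]. Qed.

Lemma CEZ (c : C) phi : CE phi -> CE (c *: phi).
Proof. by move=> h; have := CE_lin (c := c) h CE0; rewrite addr0. Qed.

Lemma CE_sum n (u : 'I_n -> K -> C) : (forall i, CE (u i)) -> CE (\sum_i u i).
Proof.
elim: n u => [|n IH] u h; first by rewrite big_ord0; exact: CE0.
by rewrite big_ord_recr/= addrC -[u _]scale1r; apply: CE_lin => //; exact: IH.
Qed.

Lemma Mtau0 : M 0 = 0.
Proof.
have := Mtau_lin K_compact K_inv 1 CE0 CE0.
by rewrite !scale1r addr0 -[LHS]addr0 => /addrI/esym.
Qed.

Lemma MtauZ (c : C) phi : CE phi -> M (c *: phi) = c *: M phi.
Proof.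
move=> h; have := Mtau_lin K_compact K_inv c h CE0.
by rewrite Mtau0 !addr0.
Qed.

Lemma MtauD phi psi : CE phi -> CE psi -> M (phi + psi) = M phi + M psi.
Proof.
by move=> h k; have := Mtau_lin K_compact K_inv 1 h k; rewrite !scale1r.
Qed.

Lemma Mtau_sum n (u : 'I_n -> K -> C) : (forall i, CE (u i)) ->
  M (\sum_i u i) = \sum_i M (u i).
Proof.
elim: n u => [|n IH] u h; first by rewrite !big_ord0 Mtau0.
rewrite !big_ord_recr/= MtauD ?IH//.
by apply: CE_sum => i; exact: h.
Qed.

(** The zero function is allowed: the terms can then be rescaled freely. *)
Definition eigsum n (e : 'I_n -> C) (u : 'I_n -> K -> C) :=
  forall i, [/\ normc (e i) = 1, CE (u i) & M (u i) = e i *: u i].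

(** The last clause lets functions of M act through the eigenvalues without leaving
    the span. *)
Lemma LS_UfP w : W w -> exists n (e : 'I_n -> C) (u : 'I_n -> K -> C),
  [/\ eigsum e u, w = \sum_i u i & forall h : 'I_n -> C, W (\sum_i h i *: u i)].
Proof.
move=> [n [c [a [Ua ->]]]].
have /choice[e he] : forall i, exists e : C, normc e = 1 /\ M (a i) = e *: a i.
  by move=> i; have [_ _ [e e1 Me]] := Ua i; exists e.
exists n, e, (fun i => c i *: a i); split=> // [i|h].
  have [e1 Me] := he i; have [ca _ _] := Ua i.
  split; [exact: e1|exact: CEZ|].
  by rewrite MtauZ// Me !scalerA mulrC.
exists n, (fun i => h i * c i), a; split=> //.
by apply: eq_bigr => i _; rewrite scalerA.
Qed.

Lemma W0 : W 0.
Proof.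
by exists 0%N, (fun=> 0), (fun=> 0); split=> [[]//|]; rewrite big_ord0.
Qed.

Lemma W_CE w : W w -> CE w.
Proof.
by move=> /LS_UfP[n [e [u [eu -> _]]]]; apply: CE_sum => i; have [] := eu i.
Qed.

Lemma iter_eigsum n (e : 'I_n -> C) (u : 'I_n -> K -> C) k : eigsum e u ->
  iter k M (\sum_i u i) = \sum_i e i ^+ k *: u i.
Proof.
move=> eu; elim: k => [|k IH].
  by apply: eq_bigr => i _; rewrite scale1r.
rewrite iterS IH Mtau_sum => [|i]; last by apply: CEZ; have [] := eu i.
apply: eq_bigr => i _; have [_ cu Mu] := eu i.
by rewrite MtauZ// Mu scalerA exprSr.
Qed.

Lemma sumfctE n (u : 'I_n -> K -> C) z : (\sum_i u i) z = \sum_i u i z.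
Proof. by rewrite fct_sumE. Qed.

Definition polyM (p : {poly C}) phi : K -> C :=
  \sum_(k < size p) p`_k *: iter k M phi.

Lemma polyM_eigsum n (e : 'I_n -> C) (u : 'I_n -> K -> C) p : eigsum e u ->
  polyM p (\sum_i u i) = \sum_i p.[e i] *: u i.
Proof.
move=> eu; rewrite /polyM.
under eq_bigr => k _ do rewrite (iter_eigsum _ eu) scaler_sumr.
rewrite exchange_big; apply: eq_bigr => i _ /=.
rewrite horner_coef scaler_suml; apply: eq_bigr => k _.
by rewrite scalerA.
Qed.

Lemma zIsub_eigsum n (e : 'I_n -> C) (u : 'I_n -> K -> C) (h : 'I_n -> C) zeta :
  eigsum e u ->
  zIsub zeta M (\sum_i h i *: u i) = \sum_i ((zeta - e i) * h i) *: u i.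
Proof.
move=> eu; rewrite /zIsub Mtau_sum => [|i]; last by apply: CEZ; have [] := eu i.
rewrite scaler_sumr -sumrB; apply: eq_bigr => i _; have [_ cu Mu] := eu i.
by rewrite MtauZ// Mu !scalerA -scalerBl mulrBl (mulrC (h i)).
Qed.

Lemma eigsumZ n (e : 'I_n -> C) (u : 'I_n -> K -> C) (h : 'I_n -> C) :
  eigsum e u -> eigsum e (fun i => h i *: u i).
Proof.
move=> eu i; have [e1 cu Mu] := eu i; split; [exact: e1|exact: CEZ|].
by rewrite MtauZ// Mu !scalerA mulrC.
Qed.

Lemma zIsub_eigsum1 n (e : 'I_n -> C) (u : 'I_n -> K -> C) zeta :
  eigsum e u ->
  zIsub zeta M (\sum_i u i) = \sum_i (zeta - e i) *: u i.
Proof.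
move=> eu; have -> : \sum_i u i = \sum_i 1 *: u i.
  by apply: eq_bigr => i _; rewrite scale1r.
rewrite (zIsub_eigsum (fun=> 1) zeta eu).
by apply: eq_bigr => i _; rewrite mulr1.
Qed.

Lemma Uv_eigenfunction zeta phi : CE phi -> normc zeta = 1 ->
  M phi = zeta *: phi -> ~ @Uv R tau K zeta -> phi = 0.
Proof.
move=> cphi z1 Mphi nU; have [//|phi0] := eqVneq phi 0.
by exfalso; apply: nU; split=> //; exists phi.
Qed.

Lemma zIsub_eq0 zeta phi : (zIsub zeta M phi = 0) <-> (M phi = zeta *: phi).
Proof.
rewrite /zIsub; split=> [/eqP|->]; last by rewrite subrr.
by rewrite subr_eq0 => /eqP.
Qed.

Lemma iter_eigenfunction zeta phi k : CE phi -> M phi = zeta *: phi ->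
  iter k M phi = zeta ^+ k *: phi.
Proof.
move=> cphi Mphi; elim: k => [|k IH]; first by rewrite scale1r.
by rewrite iterS IH MtauZ// Mphi scalerA exprSr.
Qed.

(** If |zeta| = 1, then w would be an eigenfunction; otherwise zeta differs from all
    the eigenvalues occurring in w. *)
Lemma W_eigen_eq0 zeta w : ~ @Uv R tau K zeta -> W w -> M w = zeta *: w -> w = 0.
Proof.
move=> nU Ww Mw; have cw := W_CE Ww.
have [z1|z1] := eqVneq (normc zeta) 1; first exact: Uv_eigenfunction nU.
have [n [e [u [eu wE _]]]] := LS_UfP Ww.
apply/funext => z; apply: (@unimodular_sum_geometric _ n e (fun i => u i z) zeta).
  by move=> i; have [e1 _ _] := eu i; apply: contra_neq z1 => <-.
move=> m; have := congr1 (fun f => f z) (iter_eigsum m eu).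
by rewrite -wE (iter_eigenfunction m cw Mw) sumfctE.
Qed.

Lemma zIsub_lin zeta (c : C) phi psi : CE phi -> CE psi ->
  zIsub zeta M (c *: phi + psi) = c *: zIsub zeta M phi + zIsub zeta M psi.
Proof.
move=> h k; rewrite /zIsub (Mtau_lin K_compact K_inv)// scalerDr opprD.
by rewrite scalerBr !scalerA (mulrC zeta) addrACA.
Qed.

Lemma zIsubB zeta phi psi : CE phi -> CE psi ->
  zIsub zeta M (phi - psi) = zIsub zeta M phi - zIsub zeta M psi.
Proof.
move=> h k; have -> : phi - psi = (-1) *: psi + phi by rewrite scaleN1r addrC.
by rewrite zIsub_lin// scaleN1r addrC.
Qed.

Lemma WB w w' : W w -> W w' -> W (w - w').
Proof.
move=> [n [c [a [Ua ->]]]] [m [c' [a' [Ua' ->]]]].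
pose d (s : 'I_n + 'I_m) : C := match s with inl i => c i | inr j => - c' j end.
pose b (s : 'I_n + 'I_m) := match s with inl i => a i | inr j => a' j end.
exists (n + m)%N, (fun i => d (fintype.split i)), (fun i => b (fintype.split i)); split.
  by move=> i; case: (fintype.split i).
rewrite big_split_ord/= -sumrN; congr (_ + _); apply: eq_bigr => i _.
  by rewrite (unsplitK (inl i)).
by rewrite (unsplitK (inr i)) /= scaleNr.
Qed.

(** On the span of the eigenfunctions zeta - M is diagonal with nonzero entries. *)
Lemma zIsub_bij_W zeta : ~ @Uv R tau K zeta -> set_bij W W (zIsub zeta M).
Proof.
move=> nU; split.
- move=> _ /LS_UfP[n [e [u [eu -> hW]]]] /=.
  rewrite (zIsub_eigsum1 zeta eu); exact: hW.
- move=> w w' /set_mem Ww /set_mem Ww' e.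
  apply/eqP; rewrite -subr_eq0; apply/eqP.
  apply: (W_eigen_eq0 nU (WB Ww Ww')); apply/zIsub_eq0.
  by rewrite zIsubB ?e ?subrr//; exact: W_CE.
move=> _ /LS_UfP[n [e [u [eu -> hW]]]] /=.
exists (\sum_i (zeta - e i)^-1 *: u i); first exact: hW.
rewrite (zIsub_eigsum _ zeta eu); apply: eq_bigr => i _.
have [e1 cu Mu] := eu i; have [ez|ez] := eqVneq (zeta - e i) 0.
  move/eqP: ez; rewrite subr_eq0 => /eqP ez.
  by rewrite -ez in Mu e1; rewrite (Uv_eigenfunction cu e1 Mu nU) scaler0.
by rewrite mulfV// scale1r.
Qed.

End EigenSums.

(** * The spectral decomposition on Hölder functions *)

Section GeometricDecay.
Variable R : realType.
Implicit Types A q : R.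

Lemma cvg_mul_expr A q : 0 < q < 1 -> A * q ^+ n @[n --> \oo] --> (0 : R).
Proof.
move=> /andP[q0 q1]; rewrite -[X in _ --> X](mulr0 A).
by apply: cvgMr; apply: cvg_expr; rewrite gtr0_norm.
Qed.

Lemma ereal_geometric_cvg0 (a : nat -> \bar R) A q : 0 < q < 1 ->
  (forall n, (0 <= a n)%E) -> (forall n, (0 < n)%N -> (a n <= (A * q ^+ n)%:E)%E) ->
  a n @[n --> \oo] --> 0%E.
Proof.
move=> q01 a0 h; apply: (@squeeze_cvge _ _ _ _ (cst 0%E) _ (fun n => (A * q ^+ n)%:E)).
- by exists 1%N => // n /= n1; rewrite a0 h.
- exact: cvg_cst.
- apply: cvg_EFin; first by exists 0%N.
  exact: cvg_mul_expr.
Qed.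

Lemma geometric_vanishing (x : nat -> R[i]) A q : 0 < q < 1 ->
  (forall n, (0 < n)%N -> normc (x n) <= A * q ^+ n) -> vanishing x.
Proof.
move=> q01 h e e0; have /cvgrPdist_le /(_ e e0) [N _ hN] := @cvg_mul_expr A q q01.
exists (maxn 1 N) => m; rewrite geq_max => /andP[m1 /hN].
rewrite /= sub0r normrN => H; apply: le_trans H; apply: le_trans (ler_norm _).
exact: h.
Qed.

End GeometricDecay.

Section SpectralProjection.
Variable R : realType.
Local Notation C := (R[i]).
Local Notation X := (Xplus R).
Local Notation XBorel := (g_sigma_algebraType (@open X)).
Local Notation Y := (Y R).
Variables (tau : probability XBorel R) (K : set Y) (alpha lambda cst : R) (r : nat).
Hypothesis supp_compact : compact (supp tau).
Hypothesis K_compact : compact K.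
Hypothesis K_inv : forall g y, supp tau g -> K y -> K (Xext g y).
Hypothesis alpha_gt0 : 0 < alpha.
Hypothesis lambda01 : 0 < lambda < 1.
Hypothesis cst_gt0 : 0 < cst.
Implicit Types (phi psi w : K -> C) (z : K) (b : R) (zeta : C).

Local Notation M := (@Mtau R tau K).
Local Notation pi := (@projLS R tau K).
Local Notation N := (@holder_norm R K alpha).
Local Notation H := (@Calpha R K alpha).
Local Notation W := (LS (@Uf R tau K)).

Hypothesis bounds : forall phi n, H phi -> (0 < n)%N ->
  [/\ (N (iter (n * r) M phi - pi phi)%R <= (cst * lambda ^+ n)%:E * N (phi - pi phi)%R)%E,
      (N (iter n M (phi - pi phi)%R) <= (cst * lambda ^+ n)%:E * N (phi - pi phi)%R)%E,
      (N (iter n M (phi - pi phi)%R) <= (cst * lambda ^+ n)%:E * N phi)%E &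
      (N (pi phi) <= cst%:E * N phi)%E].

Lemma H_CE phi : H phi -> CE phi. Proof. by case. Qed.

Lemma H_Mtau phi : H phi -> H (M phi).
Proof.
move=> /(CalphaP alpha_gt0)[b b0 h]; apply/(CalphaP alpha_gt0).
have [A A0 hA] := Mtau_hbd supp_compact K_compact K_inv alpha_gt0.
by exists (A * b); [exact: mulr_ge0|exact: hA].
Qed.

Lemma H_iter_Mtau k phi : H phi -> H (iter k M phi).
Proof. by move=> h; elim: k => // k; exact: H_Mtau. Qed.

Lemma iter_Mtau_lin k (c : C) phi psi : H phi -> H psi ->
  iter k M (c *: phi + psi) = c *: iter k M phi + iter k M psi.
Proof.
move=> h h'; elim: k => // k IH.
by rewrite !iterS IH (Mtau_lin K_compact K_inv)//; apply: H_CE; exact: H_iter_Mtau.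
Qed.

Lemma iter_MtauB k phi psi : H phi -> H psi ->
  iter k M (phi - psi) = iter k M phi - iter k M psi.
Proof.
move=> h h'; rewrite addrC -scaleN1r iter_Mtau_lin// scaleN1r.
by rewrite addrC.
Qed.

Lemma holder_norm_mul_le phi psi b c : 0 <= c -> 0 <= b -> hbd alpha b psi ->
  (N phi <= c%:E * N psi)%E -> hbd alpha (c * (b *+ 2)) phi.
Proof.
move=> c0 b0 h le; apply: holder_norm_hbd; apply: (le_trans le).
by rewrite EFinM; apply: lee_wpmul2l; [rewrite lee_fin|exact: hbd_holder_norm].
Qed.

Let lam_ge0 n : 0 <= cst * lambda ^+ n.
Proof. by rewrite mulr_ge0 ?exprn_ge0 ?ltW//; case/andP: lambda01. Qed.

(** The bounds concern the iterates from the first one on; the summand 1 makes this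
    constant serve the zeroth as well. *)
Definition decay_cst : R := 1 + cst *+ 2.

Lemma decay_cst_ge0 : 0 <= decay_cst.
Proof. by rewrite addr_ge0// mulrn_wge0// ltW. Qed.

Lemma proj_hbd phi b : 0 <= b -> hbd alpha b phi -> hbd alpha (decay_cst * b) (pi phi).
Proof.
move=> b0 h; have Hphi : H phi by apply/(CalphaP alpha_gt0); exists b.
have [_ _ _ h4] := bounds Hphi (ltn0Sn 0).
apply: hbd_le (holder_norm_mul_le (ltW cst_gt0) b0 h h4).
by rewrite /decay_cst mulrDl mul1r mulrnAr mulrnAl lerDr.
Qed.

Lemma H_proj phi : H phi -> H (pi phi).
Proof.
move=> /(CalphaP alpha_gt0)[b b0 h]; apply/(CalphaP alpha_gt0).
by exists (decay_cst * b); [rewrite mulr_ge0// decay_cst_ge0|exact: proj_hbd].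
Qed.

Lemma complement_decay phi b n : 0 <= b -> hbd alpha b phi ->
  hbd alpha (decay_cst * b * lambda ^+ n) (iter n M (phi - pi phi)).
Proof.
move=> b0 h; have Hphi : H phi by apply/(CalphaP alpha_gt0); exists b.
case: n => [|n].
  rewrite mulr1 /decay_cst mulrDl mul1r; apply: hbdB => //.
  have [_ _ _ h4] := bounds Hphi (ltn0Sn 0).
  by rewrite mulrnAl -mulrnAr; exact: holder_norm_mul_le (ltW cst_gt0) b0 h h4.
have [_ _ h3 _] := bounds Hphi (ltn0Sn n).
apply: hbd_le (holder_norm_mul_le (lam_ge0 _) b0 h h3).
rewrite mulrnAr mulrAC -mulrnAl -mulrnAl; apply: ler_wpM2r.
  by rewrite exprn_ge0// ltW//; case/andP: lambda01.
by apply: ler_wpM2r => //; rewrite lerDr.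
Qed.

(** Should phi have no decomposition at all, then pi phi = 0 and the decay of the
    iterates of phi - pi phi = phi provides one. *)
Lemma proj_W phi : H phi -> W (pi phi).
Proof.
move=> Hphi; pose P := [set psi | W psi /\ B0 tau (phi - psi)].
have [|nP] := pselect (exists psi, P psi).
  by move=> /(xgetPex 0)[].
have nP' psi : ~ P psi by move=> Ppsi; apply: nP; exists psi.
have pi0 : pi phi = 0 by rewrite /projLS; exact: xgetPN nP'.
exfalso; apply: (nP' 0); split; first exact: W0.
have /(CalphaP alpha_gt0)[b b0 h] := Hphi.
rewrite subr0; split; first exact: H_CE.
apply: (@ereal_geometric_cvg0 _ _ (decay_cst * b) lambda) => // n.
  exact: sup0_ge0.
move=> _; have [hn _] := complement_decay n b0 h.
rewrite pi0 subr0 in hn; apply: sup_norm_le => //.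
by rewrite !mulr_ge0 ?decay_cst_ge0// exprn_ge0// ltW//; case/andP: lambda01.
Qed.

Lemma vanishing_complement phi z : H phi ->
  vanishing (fun n => iter n M (phi - pi phi) z).
Proof.
move=> /(CalphaP alpha_gt0)[b b0 h].
apply: (@geometric_vanishing _ _ (decay_cst * b) lambda) => // n _.
exact: (complement_decay n b0 h).1.
Qed.

Lemma vanishingB (x y : nat -> C) : vanishing x -> vanishing y ->
  vanishing (fun n => x n - y n).
Proof.
move=> hx hy e e0; have e20 : 0 < e / 2 by rewrite divr_gt0.
have [N1 h1] := hx _ e20; have [N2 h2] := hy _ e20.
exists (maxn N1 N2) => m; rewrite geq_max => /andP[/h1 k1 /h2 k2].
by rewrite (le_trans (ler_normcB _ _))// (splitr e) lerD.
Qed.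

Lemma vanishingZ (c : C) (x : nat -> C) : vanishing x -> vanishing (fun n => c * x n).
Proof.
move=> hx e e0; have c0 : 0 < normc c + 1 by rewrite ltr_wpDl// normc_ge0.
have [N1 h1] := hx (e / (normc c + 1)) (divr_gt0 e0 c0).
exists N1 => m /h1 h; rewrite ComplexField.Normc.normcM.
apply: (@le_trans _ _ ((normc c + 1) * (e / (normc c + 1)))).
  by rewrite ler_pM ?normc_ge0// lerDl.
by rewrite mulrC divfK// gt_eqF.
Qed.

Lemma vanishing_sub (x : nat -> C) (s : nat -> nat) : (forall n, (n <= s n)%N) ->
  vanishing x -> vanishing (fun n => x (s n)).
Proof.
by move=> hs hx e /hx[N1 h1]; exists N1 => m Nm; apply: h1; exact: leq_trans (hs m).
Qed.

(** M^(nr) phi converges both to pi phi and, up to a term tending to 0, agrees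
    with M^(nr) (pi phi); so M^((n + 1) r) w - M^(nr) w tends to 0 for w = pi phi,
    and it is a sum of unimodular exponentials. *)
Lemma proj_fixed phi : (0 < r)%N -> H phi -> iter r M (pi phi) = pi phi.
Proof.
move=> r0 Hphi; set w := pi phi; have Hw := H_proj Hphi.
have /LS_UfP - /(_ K_compact K_inv)[n [e [u [eu wE _]]]] := proj_W Hphi.
apply/funext => z; apply/eqP; rewrite -subr_eq0; apply/eqP.
have van1 : vanishing (fun k => iter (k * r) M phi z - w z).
  have /(CalphaP alpha_gt0)[b b0 hb] := CalphaB alpha_gt0 Hphi Hw.
  apply: (@geometric_vanishing _ _ (cst * (b *+ 2)) lambda) => // k k0.
  have [h1 _ _ _] := bounds Hphi k0.
  have := (holder_norm_mul_le (lam_ge0 k) b0 hb h1).1 z.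
  by rewrite mulrAC.
have van2 : vanishing (fun k => iter (k * r) M w z - w z).
  have := vanishingB van1 (vanishing_sub (s := fun k => (k * r)%N) (fun k => leq_pmulr k r0)
    (vanishing_complement z Hphi)).
  move=> h e' /h[N0 hN]; exists N0 => m /hN; rewrite iter_MtauB// -/w.
  have BE (f g : K -> C) (c : C) : f z - c - (f - g) z = g z - c.
    by rewrite -[(f - g) z]/(f z - g z); ring.
  by rewrite BE.
have E k : iter (k * r) M w z = \sum_i (e i ^+ r) ^+ k * u i z.
  rewrite -/w in wE; rewrite wE (iter_eigsum K_compact K_inv _ eu) sumfctE.
  by apply: eq_bigr => i _; rewrite mulnC exprM.
have D k : iter (k.+1 * r) M w z - iter (k * r) M w z =
    \sum_i (e i ^+ r) ^+ k * ((e i ^+ r - 1) * u i z).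
  rewrite !E -sumrB; apply: eq_bigr => i _; rewrite exprSr; ring.
have := @vanishing_unimodular_sum _ n (fun i => e i ^+ r)
  (fun i => (e i ^+ r - 1) * u i z) _ _ 0.
rewrite -(D 0%N) mul1n mul0n; apply.
  by move=> i; have [e1 _ _] := eu i; rewrite normcX e1 expr1n.
move=> e' e'0; have [N1 hN1] := vanishingB (vanishing_sub (s := S) (fun k => leqnSn k) van2) van2 e'0.
by exists N1 => m /hN1; rewrite -D opprB addrA subrK.
Qed.

Lemma geometric_eq0 (x : C) (A q : R) : 0 < q < 1 ->
  (forall k, normc x <= A * q ^+ k) -> x = 0.
Proof.
move=> q01 h; apply/eqP; rewrite -normc_eq0 eq_le normc_ge0 andbT.
apply/ler_addgt0Pl => e e0; rewrite addr0.
have [n hn] := @geometric_vanishing _ (fun=> x) A q q01 (fun k _ => h k) e e0.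
exact: hn (leqnn n).
Qed.

(** If zeta is neither in the closed disc of radius lambda nor an eigenvalue of
    modulus one, then it is not an eigenvalue at all: the two components of
    (zeta - M) phi vanish separately, and the component of phi on which the
    iterates decay like lambda ^ n cannot be an eigenfunction for zeta. *)
Lemma zIsub_inj_H zeta phi : lambda < normc zeta -> ~ @Uv R tau K zeta ->
  H phi -> zIsub zeta M phi = 0 -> phi = 0.
Proof.
move=> lz nU Hphi Mphi; set w := pi phi; have Hw := H_proj Hphi.
have Heta : H (phi - w) by exact: CalphaB.
have [n [e [u [eu wE _]]]] := LS_UfP K_compact K_inv (proj_W Hphi).
rewrite -/w in wE.
pose y := zIsub zeta M w.
have yE : y = \sum_i (zeta - e i) *: u i by rewrite /y wE (zIsub_eigsum1 K_compact K_inv zeta eu).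
have Hy : H y.
  by rewrite /y /zIsub; apply: CalphaB => //; [exact: CalphaZ|exact: H_Mtau].
have Meta : M (phi - w) = zeta *: (phi - w) + y.
  have : zIsub zeta M (phi - w) = - y.
    by rewrite (zIsubB K_compact K_inv) ?Mphi ?sub0r//; exact: H_CE.
  by move=> ze; rewrite -[y]opprK -ze /zIsub opprB addrCA subrr addr0.
have iterE k z : iter k.+1 M (phi - w) z - zeta * iter k M (phi - w) z =
    \sum_i e i ^+ k * ((zeta - e i) * u i z).
  rewrite iterSr Meta iter_Mtau_lin// yE.
  rewrite (iter_eigsum K_compact K_inv k (eigsumZ K_compact K_inv (fun i => zeta - e i) eu)).
  have AE (a s : K -> C) : (zeta *: a + s) z - zeta * a z = s z.
    by rewrite -[(zeta *: a + s) z]/(zeta * a z + s z); ring.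
  by rewrite AE sumfctE.
have y0 : y = 0.
  apply/funext => z; rewrite yE sumfctE.
  have := @vanishing_unimodular_sum _ n e (fun i => (zeta - e i) * u i z) _ _ 0.
  under eq_bigr do rewrite expr0 mul1r.
  apply; first by move=> i; have [e1 _ _] := eu i.
  have vz := vanishing_complement z Hphi.
  have h := vanishingB (vanishing_sub (s := S) (fun k => leqnSn k) vz) (vanishingZ zeta vz).
  by move=> e' /h[N1 hN]; exists N1 => m /hN; rewrite -/w iterE.
have w0 : w = 0.
  by apply: (W_eigen_eq0 K_compact K_inv nU (proj_W Hphi)); apply/zIsub_eq0.
have Mphi' : M phi = zeta *: phi by exact/zIsub_eq0.
have z0 : 0 < normc zeta by apply: lt_trans lz; case/andP: lambda01.
have q01 : 0 < lambda / normc zeta < 1.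
  by rewrite divr_gt0 ?ltr_pdivrMr ?mul1r//; case/andP: lambda01.
have /(CalphaP alpha_gt0)[b b0 hb] := Hphi.
apply/funext => z; apply: (@geometric_eq0 _ (decay_cst * b) _ q01) => k.
have := (complement_decay k b0 hb).1 z; rewrite -/w w0 subr0.
rewrite (iter_eigenfunction K_compact K_inv k (H_CE Hphi) Mphi').
rewrite [normc _]ComplexField.Normc.normcM normcX expr_div_n mulrA.
by rewrite ler_pdivlMr ?exprn_gt0// mulrC.
Qed.

Lemma polyM_hbd (p : {poly C}) : exists2 B : R, 0 <= B &
  forall b phi, 0 <= b -> hbd alpha b phi -> hbd alpha (B * b) (polyM tau p phi).
Proof.
have [A A0 hA] := Mtau_hbd supp_compact K_compact K_inv alpha_gt0.
have hAk k b phi : 0 <= b -> hbd alpha b phi -> hbd alpha (A ^+ k * b) (iter k M phi).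
  move=> b0 h; elim: k => [|k IH]; first by rewrite mul1r.
  by rewrite exprS -mulrA iterS; apply: hA => //; rewrite mulr_ge0// exprn_ge0.
exists (\sum_(k < size p) normc p`_k * A ^+ k).
  by apply: sumr_ge0 => k _; rewrite mulr_ge0 ?normc_ge0 ?exprn_ge0.
move=> b phi b0 h; rewrite mulr_suml; apply: hbd_sum => k.
by rewrite -mulrA; apply: hbdZ; exact: hAk.
Qed.

(** On the range of pi the operator M is killed by X ^ r - 1; if zeta is a root,
    then it is a simple one, and the cofactor of X - zeta kills M as well because
    zeta is not an eigenvalue. *)
Lemma proj_annihilator zeta : (0 < r)%N -> ~ @Uv R tau K zeta ->
  exists p : {poly C}, p.[zeta] != 0 /\ forall phi, H phi -> polyM tau p (pi phi) = 0.
Proof.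
move=> r0 nU; pose P : {poly C} := 'X^r - 1.
have PM phi n (e : 'I_n -> C) (u : 'I_n -> K -> C) : H phi -> eigsum tau e u ->
    pi phi = \sum_i u i -> \sum_i P.[e i] *: u i = 0.
  move=> Hphi eu wE; have := proj_fixed r0 Hphi.
  rewrite wE (iter_eigsum K_compact K_inv _ eu) => fixE.
  transitivity (\sum_i e i ^+ r *: u i - \sum_i u i); last by rewrite fixE subrr.
  rewrite -sumrB; apply: eq_bigr => i _.
  by rewrite !hornerE scalerBl scale1r.
have [zr|zr] := eqVneq (P.[zeta]) 0; last first.
  exists P; split=> // phi Hphi.
  have [n [e [u [eu wE _]]]] := LS_UfP K_compact K_inv (proj_W Hphi).
  by rewrite wE (polyM_eigsum K_compact K_inv _ eu); exact: PM wE.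
have /factor_theorem[q Pq] : root P zeta by apply/rootP.
have zeta0 : zeta != 0.
  apply: contra_eq_neq zr => ->; rewrite !hornerE expr0n gtn_eqF// sub0r.
  by rewrite oppr_eq0 oner_eq0.
exists q; split.
  have := congr1 (fun s : {poly C} => s^`().[zeta]) Pq.
  rewrite /P derivB derivXn derivC subr0 derivM derivXsubC mulr1.
  rewrite hornerMn hornerXn !hornerE subrr mulr0 add0r => <-.
  by rewrite -mulr_natr mulf_neq0 ?expf_neq0// pnatr_eq0 -lt0n.
move=> phi Hphi.
have [n [e [u [eu wE hW]]]] := LS_UfP K_compact K_inv (proj_W Hphi).
rewrite wE (polyM_eigsum K_compact K_inv _ eu).
apply: (W_eigen_eq0 K_compact K_inv nU (hW _)); apply/zIsub_eq0.
rewrite (zIsub_eigsum K_compact K_inv _ _ eu).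
transitivity (- \sum_i P.[e i] *: u i); last by rewrite (PM _ _ _ _ Hphi eu wE) oppr0.
rewrite -sumrN; apply: eq_bigr => i _; rewrite -scaleNr Pq !hornerE.
by congr (_ *: _); ring.
Qed.

(** From p - p(zeta) = q (X - zeta) and p(M) = 0 on the range of pi it follows that
    q(M) / p(zeta) inverts zeta - M there; being a polynomial in M, it is bounded. *)
Lemma resolvent_W zeta : (0 < r)%N -> ~ @Uv R tau K zeta ->
  exists2 B : R, 0 <= B & forall phi b, 0 <= b -> hbd alpha b phi ->
    exists v, [/\ W v, zIsub zeta M v = pi phi & hbd alpha (B * b) v].
Proof.
move=> r0 nU; have [p [pz pM]] := proj_annihilator r0 nU.
have /factor_theorem[q pq] : root (p - (p.[zeta])%:P) zeta.
  by apply/rootP; rewrite !hornerE subrr.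
have [B B0 hB] := polyM_hbd q; pose c := (p.[zeta])^-1.
exists (normc c * (B * decay_cst)).
  by rewrite !mulr_ge0 ?normc_ge0 ?decay_cst_ge0.
move=> phi b b0 h; have Hphi : H phi by apply/(CalphaP alpha_gt0); exists b.
have [n [e [u [eu wE hW]]]] := LS_UfP K_compact K_inv (proj_W Hphi).
have vE : c *: polyM tau q (pi phi) = \sum_i (c * q.[e i]) *: u i.
  rewrite wE (polyM_eigsum K_compact K_inv _ eu) scaler_sumr.
  by apply: eq_bigr => i _; rewrite scalerA.
exists (c *: polyM tau q (pi phi)); split; first by rewrite vE; exact: hW.
  rewrite vE (zIsub_eigsum K_compact K_inv _ _ eu).
  have pM0 : \sum_i p.[e i] *: u i = 0.
    by rewrite -(polyM_eigsum K_compact K_inv _ eu) -wE pM.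
  transitivity (\sum_i u i - c *: \sum_i p.[e i] *: u i); last first.
    by rewrite pM0 scaler0 subr0 wE.
  rewrite scaler_sumr -sumrB; apply: eq_bigr => i _.
  rewrite (scalerA c p.[e i]) -[X in _ = X - _]scale1r -scalerBl.
  congr (_ *: _).
  have := congr1 (fun s : {poly C} => s.[e i]) pq; rewrite !hornerE => pe.
  have -> : 1 - c * p.[e i] = c * (p.[zeta] - p.[e i]) by rewrite mulrBr /c mulVf.
  have -> : p.[zeta] - p.[e i] = - (q.[e i] * (e i - zeta)) by rewrite -pe opprB.
  by transitivity ((zeta - e i) * c * q.[e i]); [|ring].
rewrite -mulrA; apply: hbdZ; rewrite -mulrA; apply: hB.
  by rewrite mulr_ge0// decay_cst_ge0.
exact: proj_hbd.
Qed.

Definition neumann zeta phi k : K -> C :=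
  \sum_(n < k) (zeta ^+ n.+1)^-1 *: iter n M (phi - pi phi).

Lemma H_neumann zeta phi k : H phi -> H (neumann zeta phi k).
Proof.
move=> Hphi; apply: Calpha_sum => // i; apply: CalphaZ => //.
by apply: H_iter_Mtau; apply: CalphaB => //; exact: H_proj.
Qed.

Lemma zIsub_neumann zeta phi k : zeta != 0 -> H phi ->
  zIsub zeta M (neumann zeta phi k) =
  (phi - pi phi) - (zeta ^+ k)^-1 *: iter k M (phi - pi phi).
Proof.
move=> z0 Hphi; have Heta : H (phi - pi phi) by apply: CalphaB => //; exact: H_proj.
elim: k => [|k IH].
  rewrite /neumann big_ord0 expr0 invr1 scale1r subrr.
  by apply/zIsub_eq0; rewrite (Mtau0 K_compact K_inv) scaler0.
have -> : neumann zeta phi k.+1 =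
    (zeta ^+ k.+1)^-1 *: iter k M (phi - pi phi) + neumann zeta phi k.
  by rewrite /neumann big_ord_recr/= addrC.
rewrite (zIsub_lin K_compact K_inv); first last.
- by apply: H_CE; exact: H_neumann.
- by apply: H_CE; exact: H_iter_Mtau.
rewrite IH /zIsub iterS scalerBr scalerA.
have -> : (zeta ^+ k.+1)^-1 * zeta = (zeta ^+ k)^-1.
  by rewrite exprSr invfM divfK.
by rewrite addrC addrA subrK.
Qed.

(** The Neumann series of zeta - M on the kernel of pi, where the powers of M
    decay like lambda ^ n. *)
Lemma resolvent_complement zeta : lambda < normc zeta ->
  exists B q : R, [/\ 0 <= B, 0 < q < 1 & forall phi b, 0 <= b -> hbd alpha b phi ->
    exists2 f, zIsub zeta M f = phi - pi phi &
      forall k, hbd alpha (B * b * q ^+ k) (f - neumann zeta phi k)].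
Proof.
move=> lz; have l0 : 0 < lambda by case/andP: lambda01.
have z0 : 0 < normc zeta by exact: lt_trans lz.
have zeta0 : zeta != 0 by rewrite -normc_eq0 gt_eqF.
pose q := lambda / normc zeta.
have q01 : 0 < q < 1 by rewrite divr_gt0// ltr_pdivrMr// mul1r.
have [q0 q1] := andP q01.
have q1' : 0 < 1 - q by rewrite subr_gt0.
pose D := (normc zeta)^-1 * decay_cst.
have D0 : 0 <= D by rewrite mulr_ge0 ?decay_cst_ge0// invr_ge0 ltW.
exists (D / (1 - q)), q; split=> //; first by rewrite divr_ge0// ltW.
move=> phi b b0 h; have Hphi : H phi by apply/(CalphaP alpha_gt0); exists b.
have Dbq0 : 0 <= D * b / (1 - q).
  by apply: divr_ge0; [exact: mulr_ge0|exact: ltW].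
have inc k : hbd alpha (D * b * q ^+ k) (neumann zeta phi k.+1 - neumann zeta phi k).
  rewrite {1}/neumann big_ord_recr/= -/(neumann zeta phi k) addrAC subrr add0r.
  have := hbdZ (zeta ^+ k.+1)^-1 (complement_decay k b0 h).
  rewrite ComplexField.Normc.normcV normcX /D /q expr_div_n exprS invfM.
  apply: hbd_le; rewrite le_eqVlt; apply/orP; left; apply/eqP; ring.
have [f hf] := hbd_limit (mulr_ge0 D0 b0) q01 inc.
have DE k : D * b / (1 - q) * q ^+ k = D / (1 - q) * b * q ^+ k by ring.
exists f; last by move=> k; rewrite -DE.
have Hf : H f.
  apply/(CalphaP alpha_gt0); exists (D * b / (1 - q) * q ^+ 0).
    by rewrite mulr1.
  by have := hf 0%N; rewrite /neumann big_ord0 subr0.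
have [A A0 hA] := Mtau_hbd supp_compact K_compact K_inv alpha_gt0.
apply/eqP; rewrite -subr_eq0; apply/eqP/funext => z.
apply: (@geometric_eq0 _ ((normc zeta + A) * (D * b / (1 - q)) + decay_cst * b) _ q01) => k.
have Hn := H_neumann zeta k Hphi.
have -> : zIsub zeta M f - (phi - pi phi) =
    zIsub zeta M (f - neumann zeta phi k) - (zeta ^+ k)^-1 *: iter k M (phi - pi phi).
  rewrite (zIsubB K_compact K_inv) ?zIsub_neumann//; try exact: H_CE.
  by rewrite [in RHS]opprD opprK [in RHS]addrA addrK.
set c := D * b / (1 - q) * q ^+ k.
have c0 : 0 <= c by apply: mulr_ge0 => //; rewrite exprn_ge0// ltW.
have h1 := (hbdB (hbdZ zeta (hf k)) (hA _ _ c0 (hf k))).1 z.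
have h2 := (hbdZ (zeta ^+ k)^-1 (complement_decay k b0 h)).1 z.
apply: (le_trans (ler_normcB _ _)); rewrite [leRHS]mulrDl; apply: lerD.
  by rewrite -[leRHS]mulrA -/c mulrDl.
apply: (le_trans h2); rewrite ComplexField.Normc.normcV normcX /q expr_div_n.
by rewrite le_eqVlt; apply/orP; left; apply/eqP; ring.
Qed.

Lemma zIsub_hbd zeta : exists2 A : R, 0 <= A & forall b phi,
  0 <= b -> hbd alpha b phi -> hbd alpha (A * b) (zIsub zeta M phi).
Proof.
have [A A0 hA] := Mtau_hbd supp_compact K_compact K_inv alpha_gt0.
exists (normc zeta + A); first by rewrite addr_ge0// normc_ge0.
by move=> b phi b0 h; rewrite mulrDl; apply: hbdB; [exact: hbdZ|exact: hA].
Qed.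

Lemma H_zIsub zeta phi : H phi -> H (zIsub zeta M phi).
Proof.
by move=> h; apply: CalphaB => //; [exact: CalphaZ|exact: H_Mtau].
Qed.

Lemma inv_onE (A : set (K -> C)) (T : (K -> C) -> K -> C) phi psi :
  set_bij A A T -> A psi -> T psi = phi -> inv_on A T phi = psi.
Proof.
move=> [_ iT _] Apsi <-; rewrite /inv_on.
by apply: pinvKV => //; exact/mem_set.
Qed.

(** The resolvent is the sum of its parts on the two summands. *)
Lemma resolvent_solution zeta : (0 < r)%N -> lambda < normc zeta -> ~ @Uv R tau K zeta ->
  exists B q : R, [/\ 0 <= B, 0 < q < 1 & forall phi b, 0 <= b -> hbd alpha b phi ->
    exists g v, [/\ zIsub zeta M g = phi, hbd alpha (B * b) g,
      W v, zIsub zeta M v = pi phi &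
      forall k, hbd alpha (B * b * q ^+ k) (g - (v + neumann zeta phi k))]].
Proof.
move=> r0 lz nU; have [B1 B10 h1] := resolvent_W r0 nU.
have [B2 [q [B20 q01 h2]]] := resolvent_complement lz.
exists (B1 + B2), q; split=> //; first exact: addr_ge0.
move=> phi b b0 h; have [v [Wv vE hv]] := h1 phi b b0 h.
have [f fE hf] := h2 phi b b0 h.
have hf0 : hbd alpha (B2 * b) f.
  by have := hf 0%N; rewrite mulr1 /neumann big_ord0 subr0.
have Hf : H f by apply/(CalphaP alpha_gt0); exists (B2 * b) => //; exact: mulr_ge0.
have Hv : H v by apply/(CalphaP alpha_gt0); exists (B1 * b) => //; exact: mulr_ge0.
exists (v + f), v; split=> //.
- have := zIsub_lin K_compact K_inv zeta 1 (H_CE Hv) (H_CE Hf).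
  by rewrite !scale1r => ->; rewrite vE fE addrCA subrr addr0.
- by rewrite mulrDl; exact: hbdD.
- move=> k; rewrite opprD addrACA subrr add0r; apply: hbd_le (hf k).
  have [q0 _] := andP q01.
  by rewrite -!mulrA ler_wpM2r ?mulr_ge0 ?exprn_ge0 ?(ltW q0)// lerDr.
Qed.

Lemma zIsub_bij_H zeta : (0 < r)%N -> lambda < normc zeta -> ~ @Uv R tau K zeta ->
  set_bij H H (zIsub zeta M).
Proof.
move=> r0 lz nU; have [B [q [B0 q01 hB]]] := resolvent_solution r0 lz nU.
split; first by move=> phi; exact: H_zIsub.
  move=> phi psi /set_mem Hphi /set_mem Hpsi e; apply/eqP; rewrite -subr_eq0; apply/eqP.
  apply: (zIsub_inj_H lz nU); first exact: CalphaB.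
  by rewrite (zIsubB K_compact K_inv) ?e ?subrr//; exact: H_CE.
move=> phi /(CalphaP alpha_gt0)[b b0 h]; have [g [v [gE hg _ _ _]]] := hB phi b b0 h.
by exists g => //; apply/(CalphaP alpha_gt0); exists (B * b) => //; exact: mulr_ge0.
Qed.

Lemma hbd_bounded_op (T : (K -> C) -> K -> C) (A : R) : 0 <= A ->
  (forall b phi, 0 <= b -> hbd alpha b phi -> hbd alpha (A * b) (T phi)) ->
  forall phi, H phi -> (N (T phi) <= (A *+ 2)%:E * N phi)%E.
Proof.
move=> A0 hT phi [cphi fphi].
have f : N phi \is a fin_num by rewrite ge0_fin_numE// holder_norm_ge0.
have b0 : 0 <= fine (N phi) by rewrite fine_ge0// holder_norm_ge0.
have h : hbd alpha (fine (N phi)) phi by apply: holder_norm_hbd; rewrite fineK.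
apply: (le_trans (hbd_holder_norm (mulr_ge0 A0 b0) (hT _ _ b0 h))).
by rewrite -mulrnAl EFinM fineK.
Qed.

Lemma invertible_zIsub zeta : (0 < r)%N -> lambda < normc zeta -> ~ @Uv R tau K zeta ->
  invertible_op H N (zIsub zeta M).
Proof.
move=> r0 lz nU; have bij := zIsub_bij_H r0 lz nU.
have [B [q [B0 q01 hB]]] := resolvent_solution r0 lz nU.
have inv_hbd b phi : 0 <= b -> hbd alpha b phi ->
    hbd alpha (B * b) (inv_on H (zIsub zeta M) phi) /\
    zIsub zeta M (inv_on H (zIsub zeta M) phi) = phi.
  move=> b0 h; have [g [v [gE hg _ _ _]]] := hB phi b b0 h.
  have Hg : H g by apply/(CalphaP alpha_gt0); exists (B * b) => //; exact: mulr_ge0.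
  by rewrite (inv_onE bij Hg gE).
have inv_H phi : H phi -> H (inv_on H (zIsub zeta M) phi) /\
    zIsub zeta M (inv_on H (zIsub zeta M) phi) = phi.
  move=> /(CalphaP alpha_gt0)[b b0 h]; have [h1 h2] := inv_hbd b phi b0 h.
  split; last exact: h2.
  by apply/(CalphaP alpha_gt0); exists (B * b) => //; exact: mulr_ge0.
have [A A0 hA] := zIsub_hbd zeta.
split; [split|exact: bij|split].
- by move=> phi; exact: H_zIsub.
- by move=> c phi psi Hphi Hpsi; apply: zIsub_lin => //; exact: H_CE.
- by exists (A *+ 2); exact: hbd_bounded_op.
- by move=> phi /inv_H[].
- move=> c phi psi /inv_H[h1 e1] /inv_H[h2 e2].
  apply: (inv_onE bij); first exact: Calpha_lin.
  by rewrite (zIsub_lin K_compact K_inv) ?e1 ?e2//; exact: H_CE.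
- by exists (B *+ 2); apply: hbd_bounded_op => // b phi b0 /(inv_hbd b phi b0)[].
Qed.

Lemma resolvent_series_cvg zeta : (0 < r)%N -> lambda < normc zeta -> ~ @Uv R tau K zeta ->
  op_norm H N
    (fun phi => inv_on H (zIsub zeta M) phi
       - (inv_on W (zIsub zeta M) (pi phi) + neumann zeta phi k))
    @[k --> \oo] --> 0%E.
Proof.
move=> r0 lz nU; have bij := zIsub_bij_H r0 lz nU.
have bijW := zIsub_bij_W K_compact K_inv nU.
have [B [q [B0 q01 hB]]] := resolvent_solution r0 lz nU.
apply: (@ereal_geometric_cvg0 _ _ (B *+ 2) q) => // k.
  apply: (@le_trans _ _ (N (inv_on H (zIsub zeta M) 0
       - (inv_on W (zIsub zeta M) (pi 0) + neumann zeta 0 k)))).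
    exact: holder_norm_ge0.
  apply: ereal_sup_ubound; exists 0 => //; split; first exact: Calpha0.
  by apply: (le_trans (hbd_holder_norm (lexx 0) (hbd0 _ _))); rewrite mul0rn lee_fin.
move=> _; apply: ge_ereal_sup => _ [phi [Hphi Nphi] <-].
have h1 : hbd alpha 1 phi by exact: holder_norm_hbd.
have [g [v [gE hg Wv vE hk]]] := hB phi 1 ler01 h1.
have Hg : H g by apply/(CalphaP alpha_gt0); exists (B * 1) => //; rewrite mulr1.
rewrite (inv_onE bij Hg gE) (inv_onE bijW Wv vE).
rewrite mulrnAl; have := hk k; rewrite mulr1 => h; apply: hbd_holder_norm h.
by rewrite mulr_ge0// exprn_ge0// ltW//; case/andP: q01.
Qed.

(** With r = 0 the first bound compares phi itself with pi phi. *)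
Lemma proj_id phi : r = 0%N -> H phi -> pi phi = phi.
Proof.
move=> r0 Hphi; apply/funext => z; apply/eqP; rewrite eq_sym -subr_eq0; apply/eqP.
have /(CalphaP alpha_gt0)[b b0 hb] := CalphaB alpha_gt0 Hphi (H_proj Hphi).
apply: (@geometric_eq0 _ (cst * (b *+ 2) * lambda) _ lambda01) => k.
have [h1 _ _ _] := bounds Hphi (ltn0Sn k); rewrite r0 muln0 /= in h1.
have := (holder_norm_mul_le (lam_ge0 _) b0 hb h1).1 z.
by have -> : cst * lambda ^+ k.+1 * (b *+ 2) = cst * (b *+ 2) * lambda * lambda ^+ k
  by rewrite exprS; ring.
Qed.

End SpectralProjection.

(** * Contraction near a minimal set *)

Section MeanStability.
Variable R : realType.
Local Notation C := (R[i]).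
Local Notation X := (Xplus R).
Local Notation XBorel := (g_sigma_algebraType (@open X)).
Local Notation Y := (Y R).
Variable tau : probability XBorel R.

Lemma open_ballY (U : set Y) x : open U -> U x ->
  exists2 e : R, 0 < e & forall y, distY x y < e -> U y.
Proof.
move=> oU Ux; have /nbhs_ballP[e /= e0 he] := open_nbhs_nbhs (conj oU Ux).
by exists e => // y xy; apply: he; rewrite ballYE.
Qed.

Lemma lebesgue_number m (U : 'I_m -> set Y) (Q : set Y) :
  (forall j, open (U j)) -> compact Q -> Q `<=` \bigcup_j U j ->
  exists2 d : R, 0 < d & forall x y, Q x -> distY x y < d -> exists j, U j x /\ U j y.
Proof.
move=> oU /compact_near_coveringP cQ QU.
pose P (d : R) (x : Y) := forall y, distY x y < d -> exists j, U j x /\ U j y.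
have H : \forall d \near 0^'+, Q `<=` P d.
  apply: (cQ _ _ P) => x Qx; have [j _ Ux] := QU x Qx.
  have [e e0 he] := open_ballY (oU j) Ux.
  have e20 : 0 < e / 2 by rewrite divr_gt0.
  exists (ball x (e / 2), [set d | d <= e / 2]) => /=.
    split; first exact: nbhsx_ballx.
    exact: nbhs_right_le.
  move=> [x' d] /= [+ de] y x'y; rewrite ballYE /= => xx'; exists j; split.
    by apply: he; apply: (lt_trans xx'); rewrite ltr_pdivrMr// ltr_pMr// ltr1n.
  apply: he; apply: (le_lt_trans (distY_triangle x' x y)).
  by rewrite (splitr e) ltrD// (lt_le_trans x'y).
near (0 : R)^'+ => d; exists d; first by near: d; exact: nbhs_right_gt.
move=> x y Qx; suff : Q `<=` P d by move=> /(_ x Qx); exact.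
by near: d.
Unshelve. all: by end_near. Qed.

Lemma word_cat (s t : seq X) z : word (s ++ t) z = word t (word s z).
Proof. exact: foldl_cat. Qed.

(** Once two points are within a Lebesgue number of the attracting set Q for the
    cover by the U j, they never separate again: after each block of n letters
    they lie in Q, hence in a common U j. *)
Lemma words_contract n m (U : 'I_m -> set Y) (Q : set Y) (c d : R) :
  0 < c < 1 ->
  (forall s, supp_words tau n s -> word s @` (\bigcup_j U j) `<=` Q /\
     forall j x y, U j x -> U j y -> distY (word s x) (word s y) <= c * distY x y) ->
  (forall x y, Q x -> distY x y < d -> exists j, U j x /\ U j y) ->
  forall k j x y s, U j x -> U j y -> distY x y < d -> supp_words tau (k * n) s ->
    distY (word s x) (word s y) <= c ^+ k * distY x y.
Proof.
move=> /andP[c0 c1] hs hd; elim=> [|k IH] j x y s Ux Uy xy [ss sup].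
  by move/eqP: ss; rewrite mul0n size_eq0 => /eqP ->; rewrite mul1r.
have s1 : supp_words tau n (take n s).
  split; first by rewrite size_takel// ss leq_pmull.
  by move=> g /mem_take; exact: sup.
have s2 : supp_words tau (k * n) (drop n s).
  split; first by rewrite size_drop ss mulSn addKn.
  by move=> g /mem_drop; exact: sup.
have [sQ /(_ j x y Ux Uy) sc] := hs _ s1.
rewrite -(cat_take_drop n s) !word_cat.
have lt1 : distY (word (take n s) x) (word (take n s) y) < d.
  by apply: le_lt_trans sc (le_lt_trans _ xy); rewrite ler_piMl ?distY_ge0// ltW.
have Qx : Q (word (take n s) x) by apply: sQ; exists x => //; exists j.
have [j' [U1 U2]] := hd _ _ Qx lt1.
rewrite (le_trans (IH j' _ _ _ U1 U2 lt1 s2))// exprSr -mulrA ler_wpM2l//.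
by rewrite exprn_ge0// ltW.
Qed.

(** A minimal set meets the union of the U j, because its orbits stay in it. *)
Lemma contraction_point (K L : set Y) : mean_stable tau -> Mintau tau L ->
  L `<=` interior K -> exists (q : Y) (n : nat) (c d : R),
    [/\ (0 < n)%N, 0 < c < 1, 0 < d & forall y, distY q y < d ->
      K y /\ forall k s, supp_words tau (k * n) s ->
        distY (word s q) (word s y) <= c ^+ k * distY q y].
Proof.
move=> [n [m [U [Q [c /= [[n0 m0] oU [Q0 cQ QU] c01 [hs hz]]]]]]] [[z Lz] cL hL] LK.
have [g Gg [j _ Ujq]] := hz z.
have Lq : L (g z) by rewrite (hL z Lz); apply: subset_closure; exists g.
have [d0 d00 hd0] := lebesgue_number (fun j => (oU j).1) cQ QU.
have [e1 e10 he1] := open_ballY (oU j).1 Ujq.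
have [e2 e20 he2] : exists2 e : R, 0 < e & forall y, distY (g z) y < e -> K y.
  have /nbhs_ballP[e /= e0 he] : nbhs (g z) K by exact: LK.
  by exists e => // y qy; apply: he; rewrite ballYE.
exists (g z), n, c, (Num.min d0 (Num.min e1 e2)); split=> //.
  by rewrite !lt_min d00 e10.
move=> y; rewrite !lt_min => /and3P[y0 y1 y2]; split; first exact: he2.
by move=> k s; apply: (words_contract c01 hs hd0 Ujq (he1 _ y1) y0).
Qed.

End MeanStability.

Section NotAllHoelderEigen.
Variable R : realType.
Local Notation C := (R[i]).
Local Notation X := (Xplus R).
Local Notation XBorel := (g_sigma_algebraType (@open X)).
Local Notation Y := (Y R).
Variables (tau : probability XBorel R) (K : set Y) (alpha : R).
Hypothesis supp_compact : compact (supp tau).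
Hypothesis K_compact : compact K.
Hypothesis K_inv : forall g y, supp tau g -> K y -> K (Xext g y).
Hypothesis alpha01 : 0 < alpha < 1.
Implicit Types (phi : K -> C) (x y z : K).

Local Notation M := (@Mtau R tau K).

(** The distance is bounded, so it is Hölder because it is Lipschitz. *)
Lemma hbd_dist z : hbd alpha (1 + pi) (fun y => (distK z y)%:C%C).
Proof.
have dpi x y : 0 <= distK x y <= 1 + pi.
  by rewrite distK_ge0/= (le_trans (fs_dist_lepi _ _))// lerDr.
split=> [y|x y].
  by rewrite normc_real ger0_norm ?distK_ge0//; case/andP: (dpi z y).
rewrite -rmorphB normc_real.
have xy := distY_triangle (\val x) (\val z) (\val y).
have yx := distY_triangle (\val y) (\val z) (\val x).
rewrite (distYC (\val y)) in yx.
apply: (@le_trans _ _ (distK x y)).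
  by rewrite ler_norml; apply/andP; split; rewrite /distK; lra.
have [d0 dle] := andP (dpi x y); have [a0 a1] := andP alpha01.
have [le1|gt1] := leP (distK x y) 1; last first.
  apply: (le_trans dle); have := ler_powR (ltW gt1) (ltW a0).
  by rewrite powRr0; apply: ler_peMr; rewrite addr_ge0// pi_ge0.
have [->|dn0] := eqVneq (distK x y) 0.
  by rewrite mulr_ge0 ?powR_ge0// addr_ge0 ?pi_ge0.
have dgt0 : 0 < distK x y by rewrite lt_neqAle eq_sym dn0.
apply: (@le_trans _ _ (distK x y `^ alpha)).
  by apply: ger1_powR; rewrite ?dgt0// ltW.
by rewrite ler_peMl ?powR_ge0// lerDl pi_ge0.
Qed.

Lemma word_mem n s (y : Y) : supp_words tau n s -> K y -> K (word s y).
Proof.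
move=> [_]; elim: s y => //= g s IH y sup Ky; apply: IH.
  by move=> h hs; apply: sup; rewrite inE hs orbT.
by apply: K_inv => //; apply: sup; rewrite inE eqxx.
Qed.

(** Near a point q around which the words contract, the oscillation of M^k phi
    tends to 0 for every Hölder function phi; for a finite sum of unimodular
    eigenfunctions it can do so only if phi is constant near q. The distance to q is
    Hölder but not constant near q, as q is not isolated. *)
Lemma Calpha_not_W L : mean_stable tau -> Mintau tau L -> L `<=` interior K ->
  (forall phi, Calpha alpha phi -> LS (@Uf R tau K) phi) -> False.
Proof.
move=> ms ML LK allW; have [a0 a1] := andP alpha01.
have [q [n [c [d [n0 c01 d0 hq]]]]] := contraction_point ms ML LK.
have [c0 c1] := andP c01.
have [y yq qy] := no_isolated_point q d0.
have [Ky hy] := hq y qy; have [Kq _] := hq q ltac:(by rewrite distYxx).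
pose x1 := toK Kq; pose x2 := toK Ky.
pose phi : K -> C := fun z => (distK x1 z)%:C%C.
have hphi := hbd_dist x1; have pi1 : 0 <= 1 + pi :> R by rewrite addr_ge0// pi_ge0.
have Hphi : Calpha alpha phi by apply/(CalphaP a0); exists (1 + pi).
have citer j : CE (iter j M phi).
  have [A A0 hA] := Mtau_hbd supp_compact K_compact K_inv a0.
  suff [b b0 hb] : exists2 b, 0 <= b & hbd alpha b (iter j M phi) by exact: hbd_CE hb.
  elim: j => [|j [b b0 hb]]; first by exists (1 + pi).
  by exists (A * b); [exact: mulr_ge0|exact: hA].
have [m [e [u [eu phiE _]]]] := LS_UfP K_compact K_inv (allW _ Hphi).
pose D k := iter (k * n) M phi x1 - iter (k * n) M phi x2.
have DE k : D k = \sum_i (e i ^+ n) ^+ k * (u i x1 - u i x2).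
  rewrite /D phiE !(iter_eigsum K_compact K_inv _ eu) !sumfctE -sumrB.
  by apply: eq_bigr => i _; rewrite -exprM mulnC -mulrBr.
have ca : 0 < c `^ alpha < 1.
  rewrite powR_gt0//=; have := @gt0_ltr_powR _ alpha a0 c 1.
  by rewrite powR1 /cst !nnegrE ler01 (ltW c0) => ->.
have cE k : (c `^ alpha) ^+ k = (c ^+ k) `^ alpha.
  by rewrite -powR_mulrn ?powR_ge0// -powRrM mulrC powRrM powR_mulrn// ltW.
have Dk k : normc (D k) <= ((1 + pi) * distY q y `^ alpha) *+ 2 * (c `^ alpha) ^+ k.
  rewrite mulrnAl; apply: normc_le_part => im; rewrite partB.
  apply: (part_iter_MtauB_le K_compact K_inv) => //.
    by rewrite !mulr_ge0// ?powR_ge0// exprn_ge0// powR_ge0.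
  move=> s ss; have K1 := word_mem ss Kq; have K2 := word_mem ss Ky.
  rewrite -[word s (\val x1)]/(\val (toK K1)) -[word s (\val x2)]/(\val (toK K2)).
  rewrite !valL_val -partB (le_trans (ler_part_normc _ _))//.
  rewrite (le_trans (hphi.2 _ _))// -mulrA ler_wpM2l//.
  rewrite cE mulrC -powRM ?exprn_ge0 ?distY_ge0 ?(ltW c0)//.
  apply: ge0_ler_powR; rewrite ?nnegrE ?distK_ge0 ?mulr_ge0 ?distY_ge0 ?exprn_ge0 ?(ltW a0) ?(ltW c0)//.
  exact: hy.
have := @vanishing_unimodular_sum _ m (fun i => e i ^+ n) (fun i => u i x1 - u i x2) _ _ 0.
rewrite -DE /D mul0n /= /phi => D0.
have : (distK x1 x1)%:C%C - (distK x1 x2)%:C%C = 0 :> C.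
  apply: D0; first by move=> i; have [e1 _ _] := eu i; rewrite normcX e1 expr1n.
  have := geometric_vanishing ca (fun k _ => Dk k).
  by move=> h e' /h[N hN]; exists N => k /hN; rewrite DE.
rewrite -rmorphB => /(@complexI R _ 0) /eqP.
rewrite {1}/distK distYxx sub0r oppr_eq0 => /eqP /distY_eq0 qy0.
by move/eqP: yq; apply; exact: esym qy0.
Qed.

(** The empty product is 1. *)
Lemma rtau_eq0_minimal : rtau tau = 0%N -> exists L, Mintau tau L.
Proof.
move=> r0; apply: contrapT => nL.
have M0 : Mintau tau = set0.
  by apply/seteqP; split=> // L ML; apply: nL; exists L.
by move: r0; rewrite /rtau M0 fsbig_set0.
Qed.

End NotAllHoelderEigen.

(** * Spectrum and resolvent *)

Theorem theorem3p64 (R : realType)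
    (tau : probability (g_sigma_algebraType (@open (Xplus R))) R)
    (tau_compact : compact (supp tau))
    (tau_stable : mean_stable tau)
    (K : set (Y R))
    (K_compact : compact K)
    (K_inv : Gtau_image tau K `<=` K)
    (K_min : \bigcup_(L in Mintau tau) L `<=` interior K)
    (alpha lambda cst : R)
    (alpha01 : 0 < alpha < 1) (lambda01 : 0 < lambda < 1) (cst0 : 0 < cst)
    (bounds : forall (phi : K -> R[i]) (n : nat),
       Calpha alpha phi -> (0 < n)%N ->
       let M := @Mtau R tau K in
       let pi := @projLS R tau K in
       let N := @holder_norm R K alpha in
       [/\ (N (iter (n * rtau tau) M phi - pi phi)%R
              <= (cst * lambda ^+ n)%:E * N (phi - pi phi)%R)%E,
           (N (iter n M (phi - pi phi)%R)
              <= (cst * lambda ^+ n)%:E * N (phi - pi phi)%R)%E,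
           (N (iter n M (phi - pi phi)%R) <= (cst * lambda ^+ n)%:E * N phi)%E &
           (N (pi phi) <= cst%:E * N phi)%E]) :
  let M := @Mtau R tau K in
  let pi := @projLS R tau K in
  let H := @Calpha R K alpha in
  let N := @holder_norm R K alpha in
  let W := LS (@Uf R tau K) in
  let D := [set z : R[i] | normc z <= lambda] `|` @Uv R tau K in
  Spec tau K alpha `<=` D /\
  (forall zeta : R[i], ~ D zeta ->
     set_bij W W (zIsub zeta M) /\
     op_norm H N
       (fun phi => inv_on H (zIsub zeta M) phi
          - (inv_on W (zIsub zeta M) (pi phi)
             + \sum_(n < k) (zeta ^+ n.+1)^-1 *: iter n M (phi - pi phi)))
       @[k --> \oo] --> 0%E).
Proof.
move=> M pi H N W D.
have a0 : 0 < alpha by case/andP: alpha01.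
have invK g y : supp tau g -> K y -> K (Xext g y).
  move=> sg Ky; apply: K_inv; exists (word [:: g]); last by exists y.
  by exists 1%N, [:: g]; split=> //; split=> // h; rewrite inE => /eqP ->.
(* If r = 0, then the bounds make pi the identity on Hölder functions, which would
   then all lie in LS(U_f); r = 0 also provides a minimal set. *)
have r0 : (0 < rtau tau)%N.
  rewrite lt0n; apply/eqP => r0; have [L ML] := rtau_eq0_minimal r0.
  apply: (Calpha_not_W tau_compact K_compact invK alpha01 tau_stable ML).
    by move=> x Lx; apply: K_min; exists L.
  move=> phi Hphi.
  rewrite -(proj_id a0 lambda01 cst0 bounds r0 Hphi).
  exact: (proj_W a0 lambda01 cst0 bounds Hphi).
have notD zeta : ~ D zeta -> lambda < normc zeta /\ ~ @Uv R tau K zeta.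
  move=> nD; split; last by move=> U; apply: nD; right.
  by rewrite ltNge; apply/negP => le; apply: nD; left.
split=> [zeta|zeta /notD[lz nU]].
  move=> sp; apply: contrapT => /notD[lz nU]; apply: sp.
  exact: (invertible_zIsub tau_compact K_compact invK a0 lambda01 cst0 bounds r0 lz nU).
split; first exact: zIsub_bij_W.
exact: (resolvent_series_cvg tau_compact K_compact invK a0 lambda01 cst0 bounds r0 lz nU).
Qed.
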